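(* Let $0\le\mu<L<\infty$, let $K\ge1$ be an integer, and let $\mathcal{A}$ be a fixed-step first-order method with step sizes $\{\eta_k^i\}$ such that $\eta_k^k\neq0$ for $k=0,\dots,K-1$. Let $\mathcal{Z}\subset\mathbf{S}_+^{K+2}\times\mathbf{R}^{K+1}$ be the lifted set for $\mathcal{F}_{\mu,L}$ (see context), let $\hat Z_i=(\hat G_i,\hat F_i)\in\mathcal{Z}$, $i=1,\dots,N$, be samples from $\mathbf{P}_Z$, let $\phi^K(G,F)=\langle(A_{\rm obj},b_{\rm obj}),(G,F)\rangle$ be the performance metric, with $A_{\rm obj}\in\mathbf{S}^{K+2}$, $b_{\rm obj}\in\mathbf{R}^{K+1}$, and let $\alpha\in(0,1]$. For $\varepsilon>0$ consider the problem (DRO-PEP) (see context) in two versions: the expectation version, with $J=1$ and $(A_{\rm obj}^1,b_{\rm obj}^1,c_{\rm obj}^1)=(A_{\rm obj},b_{\rm obj},0)$; and the CVaR version, with $J=2$, $(A_{\rm obj}^1,b_{\rm obj}^1,c_{\rm obj}^1)=\alpha^{-1}(A_{\rm obj},b_{\rm obj},\alpha-1)$ and $(A_{\rm obj}^2,b_{\rm obj}^2,c_{\rm obj}^2)=(0,0,1)$. Then: (1) As $\varepsilon\to0^+$, the optimal values of the expectation version and the CVaR version converge respectively to the in-sample average-case performance $\frac1N\sum_{i=1}^N\phi^K(\hat Z_i)$ and to the in-sample CVaR performance $\mathbf{CVaR}_\alpha(\phi^K(\hat Z))$, where $\hat Z\sim\frac1N\sum_{i=1}^N\delta_{\hat Z_i}$.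 (2) There exists $\bar\varepsilon>0$ such that for any $\varepsilon\ge\bar\varepsilon$ the optimal values of both versions equal the worst-case performance $\sup_{Z\in\mathcal{Z}}\phi^K(Z)$.
   Context: Notation: $\mathbf{S}^n$ ($\mathbf{S}^n_+$) is the space of symmetric (positive semidefinite) $n\times n$ matrices. On $\mathbf{S}^{K+2}\times\mathbf{R}^{K+1}$, $\langle(X,Y),(G,F)\rangle=\mathrm{tr}(X^TG)+Y^TF$ and $\|(G,F)\|=\sqrt{\|G\|_F^2+\|F\|_2^2}$ ($\|\cdot\|_F$ Frobenius); its dual norm $\|\cdot\|_*$ is the same norm. $\mathbf{CVaR}_\alpha(X)=\inf_{t\in\mathbf{R}}(t+\alpha^{-1}\mathbf{E}(X-t)_+)$. Fixed-step first-order method: $x^{k+1}=x^k-\sum_{i=0}^k\eta_k^i g^i$, $g^i=\nabla f(x^i)$, with scalars $\eta_k^i$ fixed independently of the instance $(f,x^0)$. Instances: pairs $(f,x^0)$ with $f:\mathbf{R}^d\to\mathbf{R}$ in $\mathcal{F}_{\mu,L}$ (differentiable, $L$-Lipschitz gradient, $\mu$-strongly convex; convex if $\mu=0$), normalized so that $x^\star=0$ is a minimizer and $f^\star=f(x^\star)=0$, and with $\|x^0-x^\star\|^2\le r^2$ ($r>0$ fixed). The large-scale regime $d\ge K+2$ is assumed. Lifting: with $f^k=f(x^k)$, $P=[\,x^0-x^\star\ \ g^0\ \cdots\ g^K\,]\in\mathbf{R}^{d\times(K+2)}$, the lift of $(f,x^0)$ is $Z=(G,F)$ with $G=P^TP\in\mathbf{S}_+^{K+2}$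 and $F=(f^0-f^\star,\dots,f^K-f^\star)\in\mathbf{R}^{K+1}$. Lifted set: let $\mathcal{I}=\{\star,0,\dots,K\}$ and $M=\{(p,q)\in\mathcal{I}\times\mathcal{I}: p\ne q\}$. The interpolation conditions of $\mathcal{F}_{\mu,L}$ are, for all $(p,q)\in M$, $$f^p\ge f^q+\langle g^q,x^p-x^q\rangle+\tfrac{1}{2(1-\mu/L)}\Big(\tfrac1L\|g^p-g^q\|^2+\mu\|x^p-x^q\|^2-\tfrac{2\mu}{L}\langle g^q-g^p,x^q-x^p\rangle\Big),$$ where $x^\star=g^\star=0$, $f^\star=0$ and $x^k=x^0-\sum_{l<k}\sum_{i\le l}\eta_l^ig^i$. Since each $x^k,g^k$ is a fixed linear combination of the columns of $P$, each condition can be written as $\langle(A_m,b_m),(G,F)\rangle\le0$ with $A_m\in\mathbf{S}^{K+2}$, $b_m\in\mathbf{R}^{K+1}$, $m=(p,q)$. The initial condition $\|x^0-x^\star\|^2\le r^2$ is written as $\langle(A_0,b_0),(G,F)\rangle+c_0\le0$ (i.e. $A_0=e_1e_1^T$, $b_0=0$, $c_0=-r^2$). Then $$\mathcal{Z}=\{(G,F)\in\mathbf{S}_+^{K+2}\times\mathbf{R}^{K+1}:\langle(A_m,b_m),(G,F)\rangle\le0\ \forall m\in M,\ \langle(A_0,b_0),(G,F)\rangle+c_0\le0\}.$$ $\mathbf{P}_Z$ is a probability distribution on $\mathcal{Z}$, the pushforward under lifting of a distribution of instances $(f,x^0)$. (DRO-PEP), for given $J$ and $(A_{\rm obj}^j,b_{\rm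 obj}^j,c_{\rm obj}^j)_{j=1}^J$ and radius $\varepsilon$: $$\begin{array}{ll}\text{minimize}&\frac1N\sum_{i=1}^Ns_i\\ \text{subject to}&c_{\rm obj}^jt-c_0\tau_i^j-\langle(X_i^j,Y_i^j),(\hat G_i,\hat F_i)\rangle+\lambda\varepsilon\le s_i,\\ &\sum_{m\in M}(y_i^j)_m(A_m,b_m)-(X_i^j,Y_i^j)+\tau_i^j(A_0,b_0)-(A_{\rm obj}^j,b_{\rm obj}^j)\in\mathbf{S}_+^{K+2}\times\{0\},\\ &\|(X_i^j,Y_i^j)\|_*\le\lambda,\qquad i=1,\dots,N,\ j=1,\dots,J,\end{array}$$ with variables $s_i\in\mathbf{R}$, $t\in\mathbf{R}$, $\tau_i^j\in\mathbf{R}_+$, $(X_i^j,Y_i^j)\in\mathbf{S}^{K+2}\times\mathbf{R}^{K+1}$, $\lambda\in\mathbf{R}_+$, $y_i^j\in\mathbf{R}_+^{|M|}$. *)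

(* Defs.v *)
From HB Require Import structures.
From mathcomp Require Import all_boot all_order all_algebra.
From mathcomp Require Import all_classical all_reals all_analysis.
From mathcomp Require Import ring.
Set Implicit Arguments.
Unset Strict Implicit.
Unset Printing Implicit Defensive.
Import Order.TTheory GRing.Theory Num.Theory.
Import numFieldNormedType.Exports.
Local Open Scope classical_set_scope.
Local Open Scope ring_scope.

(* Pairs (G, F) with G a square matrix of order K + 2 and F in R^(K+1); symmetry
   of G is not built into the type, it is imposed by [symmx] or [psd]. *)
Notation gf_space R K := ('M[R]_K.+2 * 'cV[R]_K.+1)%type.

Notation borel_gf R K := (g_sigma_algebraType (@open (gf_space R K))).

Section Spaces.
Variable R : realType.

Definition symmx n (A : 'M[R]_n) : Prop := A^T = A.

Definition psd n (A : 'M[R]_n) : Prop :=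
  symmx A /\ forall u : 'cV[R]_n, 0 <= (u^T *m A *m u) 0 0.

Definition dotv n (u v : 'cV[R]_n) : R := (u^T *m v) 0 0.

Definition pairing K (U V : gf_space R K) : R :=
  \tr (U.1^T *m V.1) + dotv U.2 V.2.

(* Frobenius norm on G, Euclidean norm on F (the library norm on matrices is the
   maximum norm). It is self-dual for [pairing]. *)
Definition gf_norm K (U : gf_space R K) : R :=
  Num.sqrt ((\sum_i \sum_j U.1 i j ^+ 2) + \sum_k U.2 k 0 ^+ 2).

(* Representing matrix, in S^n, of G = P^T P |-> <P u, P v>. *)
Definition symouter n (u v : 'cV[R]_n) : 'M[R]_n :=
  2^-1 *: (u *m v^T + v *m u^T).

End Spaces.

(* [None] is the index of the minimizer, [Some k] that of the k-th iterate. *)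
Notation pep_index K := (option 'I_K.+1).

Notation pep_pairs K := {pq : pep_index K * pep_index K | pq.1 != pq.2}.

Section LiftedSet.
Variables (R : realType) (mu L : R) (K : nat).
(* [eta k i] is the coefficient of g^i in the update from x^k to x^(k+1);
   only the values with i <= k < K are used. *)
Variables (eta : nat -> nat -> R) (r : R).

(* Coordinates of g^p, x^p in the columns of P = [x^0 - x* | g^0 | ... | g^K]
   and of f^p - f* in the entries of F. *)
Definition gcoef (p : pep_index K) : 'cV[R]_K.+2 :=
  if p is Some k then delta_mx (lift ord0 k) 0 else 0.

Definition xcoef (p : pep_index K) : 'cV[R]_K.+2 :=
  if p is Some k then
    delta_mx ord0 0 -
    \sum_(l < K.+1 | (l < k)%N) \sum_(i < K.+1 | (i <= l)%N)
      eta l i *: gcoef (Some i)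
  else 0.

Definition fcoef (p : pep_index K) : 'cV[R]_K.+1 :=
  if p is Some k then delta_mx k 0 else 0.

(* The pair (A_m, b_m) for m = (p, q). *)
Definition interp_coef (p q : pep_index K) : gf_space R K :=
  (symouter (gcoef q) (xcoef p - xcoef q) +
   (2 * (1 - mu / L))^-1 *:
     (L^-1 *: symouter (gcoef p - gcoef q) (gcoef p - gcoef q) +
      mu *: symouter (xcoef p - xcoef q) (xcoef p - xcoef q) -
      (2 * mu / L) *: symouter (gcoef q - gcoef p) (xcoef q - xcoef p)),
   fcoef q - fcoef p).

(* On a Gram matrix, <(A_m, b_m), (P^T P, F)> <= 0 is the interpolation
   inequality for the pair m = (p, q). *)
Lemma interp_coefE d (P : 'M[R]_(d, K.+2)) (F : 'cV[R]_K.+1)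
    (p q : pep_index K) :
  let x s := P *m xcoef s in
  let g s := P *m gcoef s in
  let f (s : pep_index K) := if s is Some k then F k 0 else 0 in
  pairing (interp_coef p q) (P^T *m P, F) =
    f q + dotv (g q) (x p - x q) +
    (2 * (1 - mu / L))^-1 *
      (L^-1 * dotv (g p - g q) (g p - g q) + mu * dotv (x p - x q) (x p - x q) -
       2 * mu / L * dotv (g q - g p) (x q - x p)) - f p.
Proof.
move=> x g f.
have dotvC n (u v : 'cV[R]_n) : dotv u v = dotv v u.
  by rewrite /dotv -[in LHS](trmxK v) -trmx_mul mxE.
have trO (u v : 'cV[R]_K.+2) :
    \tr (u *m v^T *m (P^T *m P)) = dotv (P *m u) (P *m v).
  rewrite dotvC /dotv -mulmxA mxtrace_mulC trmx_mul -!mulmxA.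
  by rewrite /mxtrace big_ord1.
pose T A := \tr (A^T *m (P^T *m P)).
have TD A B : T (A + B) = T A + T B.
  by rewrite /T [_^T]raddfD/= mulmxDl raddfD.
have TZ a A : T (a *: A) = a * T A.
  by rewrite /T [_^T]linearZ/= -scalemxAl linearZ.
have TN A : T (- A) = - T A by rewrite -scaleN1r TZ mulN1r.
have TO (u v : 'cV[R]_K.+2) : T (symouter u v) = dotv (P *m u) (P *m v).
  rewrite /symouter TZ TD /T !trmx_mul !trmxK !trO (dotvC _ (P *m v)).
  by field.
have fE s : dotv (fcoef s) F = f s.
  rewrite /dotv /fcoef /f; case: s => [k|]; last by rewrite trmx0 mul0mx mxE.
  by rewrite trmx_delta -rowE mxE.
have fB : dotv (fcoef q - fcoef p) F = f q - f p.
  by rewrite -!fE /dotv [_^T]raddfB/= mulmxBl !mxE.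
rewrite /pairing /interp_coef fB/= -/(T _).
by rewrite !(TD, TZ, TN, TO) !mulmxBr -/(x p) -/(x q) -/(g p) -/(g q); ring.
Qed.

Definition init_coef : gf_space R K := (delta_mx ord0 ord0, 0).

Definition init_cst : R := - r ^+ 2.

Definition lifted_set : set (gf_space R K) :=
  [set Z | [/\ psd Z.1,
    forall m : pep_pairs K, pairing (interp_coef (val m).1 (val m).2) Z <= 0
    & pairing init_coef Z + init_cst <= 0]].

End LiftedSet.

Section DROPEP.
Variables (R : realType) (mu L : R) (K : nat) (eta : nat -> nat -> R) (r : R).
Variables (N : nat) (Zhat : 'I_N -> gf_space R K).
Variables (J : nat) (obj : 'I_J -> gf_space R K) (cobj : 'I_J -> R).

Record dro_var := DROVar {
  dv_s : 'I_N -> R;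
  dv_t : R;
  dv_tau : 'I_N -> 'I_J -> R;
  dv_XY : 'I_N -> 'I_J -> gf_space R K;
  dv_lambda : R;
  dv_y : 'I_N -> 'I_J -> pep_pairs K -> R }.

Definition dro_feasible (eps : R) (v : dro_var) : Prop :=
  0 <= dv_lambda v /\
  forall (i : 'I_N) (j : 'I_J),
  let W := \sum_(m : pep_pairs K)
             dv_y v i j m *: interp_coef mu L eta (val m).1 (val m).2
           - dv_XY v i j + dv_tau v i j *: init_coef R K - obj j in
  [/\ [/\ 0 <= dv_tau v i j,
          forall m, 0 <= dv_y v i j m
        & symmx (dv_XY v i j).1],
      cobj j * dv_t v - init_cst r * dv_tau v i j
        - pairing (dv_XY v i j) (Zhat i) + dv_lambda v * eps <= dv_s v i,
      psd W.1 /\ W.2 = 0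
    & gf_norm (dv_XY v i j) <= dv_lambda v].

Definition dro_objective (v : dro_var) : R := N%:R^-1 * \sum_i dv_s v i.

Definition dro_pep (eps : R) : \bar R :=
  ereal_inf [set (dro_objective v)%:E | v in dro_feasible eps].

End DROPEP.

Section Versions.
Variables (R : realType) (mu L : R) (K : nat) (eta : nat -> nat -> R) (r : R).
Variables (N : nat) (Zhat : 'I_N -> gf_space R K).
Variables (A : 'M[R]_K.+2) (b : 'cV[R]_K.+1).

Definition dro_pep_expectation (eps : R) : \bar R :=
  dro_pep mu L eta r Zhat (fun _ : 'I_1 => (A, b)) (fun=> 0) eps.

Definition dro_pep_cvar (alpha eps : R) : \bar R :=
  dro_pep mu L eta r Zhat
    (fun j : 'I_2 => if j == ord0 then alpha^-1 *: (A, b) else (0, 0))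
    (fun j : 'I_2 => if j == ord0 then alpha^-1 * (alpha - 1) else 1) eps.

End Versions.

Section CVaR.
Context d (T : measurableType d) (R : realType).
Local Open Scope ereal_scope.

Definition CVaR (P : probability T R) (alpha : R) (X : T -> R) : \bar R :=
  ereal_inf [set t%:E + (alpha^-1)%:E * 'E_P[fun w => Num.max (X w - t)%R 0%R]
            | t in [set: R]].

End CVaR.

Section Empirical.
Context d (T : measurableType d) (R : realType).
Variables (N : nat) (z : 'I_N -> T).
Local Open Scope ereal_scope.

(* The hypothesis 0 < N makes this a probability. *)
Definition empirical of (0 < N)%N : set T -> \bar R :=
  fun A => (N%:R^-1)%:E * \sum_(i < N) \d_(z i) A.

Hypothesis N0 : (0 < N)%N.

Let empirical0 : empirical N0 set0 = 0.
Proof. by rewrite /empirical big1 ?mule0// => i _; rewrite dirac0. Qed.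

Let empirical_ge0 A : 0 <= empirical N0 A.
Proof. by rewrite mule_ge0 ?lee_fin// sume_ge0. Qed.

Let empirical_sigma_additive : semi_sigma_additive (empirical N0).
Proof.
pose m := msum (R := R) (fun k => \d_(z (odflt (Ordinal N0) (insub k)))) N.
have N_ge0 : (0 <= N%:R^-1 :> R)%R by rewrite invr_ge0.
have -> : empirical N0 = mscale (NngNum N_ge0) m.
  apply/funext => A; rewrite /empirical /mscale /m /msum/=; congr (_ * _).
  by apply: eq_bigr => i _; rewrite valK.
exact: measure_semi_sigma_additive.
Qed.

HB.instance Definition _ := isMeasure.Build _ _ _ (empirical N0)
  empirical0 empirical_ge0 empirical_sigma_additive.

Let empirical_setT : empirical N0 setT = 1.
Proof.
rewrite /empirical (eq_bigr (fun=> 1)) => [|i _]; last by rewrite diracT.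
rewrite sumEFin sumr_const card_ord -EFinM mulVf// pnatr_eq0 -lt0n//.
Qed.

HB.instance Definition _ :=
  Measure_isProbability.Build _ _ _ (empirical N0) empirical_setT.

End Empirical.
Arguments empirical {d T R N} z _ _.

(* Main.v *)
Require Import Defs.
From mathcomp Require Import all_boot all_order all_algebra.
From mathcomp Require Import all_classical all_reals all_analysis.
From mathcomp Require Import measurable_realfun ring lra.
Import Order.TTheory GRing.Theory Num.Theory.
Import numFieldNormedType.Exports.
Local Open Scope classical_set_scope.
Local Open Scope ring_scope.

(** The constraints of (DRO-PEP) are Lagrangian certificates.  Pairing the
    semidefinite constraint for the indices i, j with a point Z of the lifted set
    eliminates the multipliers and leaves

      cobj_j t + <obj_j, Z> + <XY_ij, Z - Zhat_i> + lambda eps <= s_i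

    ([dro_feasible_bound]).  Everything else follows from two choices of Z for
    the lower bounds and two choices of the dual variables for the upper bounds.

    Small radius.  The choice Z = Zhat_i removes the transport term, so that s_i
    is at least the in-sample value for every radius
    ([dro_feasible_sample]).  Conversely XY_ij = - obj_j with all other
    multipliers zero is feasible and costs only lambda eps more
    ([dro_pep_le_transport]), lambda being a bound on the norms of the
    objectives.  Squeezing gives both limits.  In the CVaR version the two
    pieces of the objective have maximum t + alpha^-1 max(phi - t, 0), whose
    average over the sample is the function of t minimised by the CVaR of the
    empirical distribution ([CVaR_empirical]).

    Large radius.  The lifted set is bounded ([lifted_set_bounded]): comparing
    an iterate with the minimizer in both directions bounds its gradient by its
    position, and positions are combinations of the initial point and of earlier
    gradients.  Once eps exceeds the diameter, lambda eps dominates the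
    transport term because the norm of XY_ij is at most lambda, and s_i is
    at least the objective at every point of the lifted set
    ([dro_feasible_worst]).  Conversely XY_ij = 0 and lambda = 0 turn the
    constraints into the dual of the performance estimation problem, whose
    value is the worst case because there is no duality gap
    ([pep_strong_duality]).  In the CVaR version one takes t to be the worst
    case, up to an arbitrarily small excess.

    The absence of a gap comes from boundedness and nonemptiness of the lifted
    set.  If gamma exceeds the worst case, then the homogenised system
    (interpolation conditions, initial condition, objective at least gamma) has
    no nonzero solution in the cone of triples of a positive semidefinite matrix, a
    nonnegative vector of values and a nonnegative scale: for positive scale a
    solution would rescale to a point of the lifted set, and for zero scale
    boundedness forces it to vanish.  This cone has a compact base, and a theorem
    of the alternative for finitely many continuous affine functions on a compact
    convex set ([compact_alternative]) provides nonnegative weights whose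
    combination is positive on the base.  The weight of the objective cannot be
    zero, since a point of the lifted set satisfies the other conditions; dividing
    by it yields the multipliers ([pep_dual_relaxed]).  *)

(** * Positive semidefinite matrices *)

Section Psd.
Context {R : realType} {n : nat}.
Implicit Types (A B G H W : 'M[R]_n) (u v w : 'cV[R]_n) (i j : 'I_n).

Lemma symmxD A B : symmx A -> symmx B -> symmx (A + B).
Proof. by rewrite /symmx => sA sB; rewrite linearD/= sA sB. Qed.

Lemma symmxZ a A : symmx A -> symmx (a *: A).
Proof. by rewrite /symmx => sA; rewrite linearZ/= sA. Qed.

Lemma symmxN A : symmx A -> symmx (- A).
Proof. by rewrite -scaleN1r; exact: symmxZ. Qed.

Lemma symmx_symouter u v : symmx (symouter u v).
Proof. by apply: symmxZ; rewrite /symmx linearD/= !trmx_mul !trmxK addrC. Qed.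

Definition gram G u v : R := (u^T *m G *m v) 0 0.

Lemma gramDl G u v w : gram G (u + v) w = gram G u w + gram G v w.
Proof. by rewrite /gram [_^T]raddfD/= !mulmxDl mxE. Qed.

Lemma gramZl G a u w : gram G (a *: u) w = a * gram G u w.
Proof. by rewrite /gram [_^T]linearZ/= -!scalemxAl mxE. Qed.

Lemma gramC G u v : symmx G -> gram G u v = gram G v u.
Proof.
move=> sG; have -> : gram G u v = (u^T *m G *m v)^T 0 0 by rewrite mxE.
by rewrite !trmx_mul trmxK sG mulmxA.
Qed.

Lemma gramDr G u v w : gram G w (u + v) = gram G w u + gram G w v.
Proof. by rewrite /gram mulmxDr mxE. Qed.

Lemma gramZr G a u w : gram G w (a *: u) = a * gram G w u.
Proof. by rewrite /gram -scalemxAr mxE. Qed.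

Lemma gramNl G u w : gram G (- u) w = - gram G u w.
Proof. by rewrite -scaleN1r gramZl mulN1r. Qed.

Lemma gramNr G u w : gram G w (- u) = - gram G w u.
Proof. by rewrite -scaleN1r gramZr mulN1r. Qed.

Lemma gram0l G w : gram G 0 w = 0.
Proof. by rewrite /gram trmx0 !mul0mx mxE. Qed.

Lemma gram_delta G i j : gram G (delta_mx i 0) (delta_mx j 0) = G i j.
Proof. by rewrite /gram trmx_delta -rowE -colE !mxE. Qed.

Lemma gram_outer v u w : gram (v *m v^T) u w = dotv v u * dotv v w.
Proof.
rewrite /gram mulmxA -mulmxA mxE big_ord1; congr (_ * _).
have -> : dotv v u = (v^T *m u)^T 0 0 by rewrite mxE.
by rewrite trmx_mul trmxK.
Qed.

Definition gramlin := (gramDl, gramDr, gramNl, gramNr, gramZl, gramZr).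

Lemma trace_symouter G u v : symmx G ->
  \tr ((symouter u v)^T *m G) = gram G u v.
Proof.
move=> sG; have trO a b : \tr (a *m b^T *m G) = gram G b a.
  rewrite -mulmxA mxtrace_mulC /gram /mxtrace big_ord1 //.
rewrite /symouter [_^T]linearZ/= [_^T]raddfD/= !trmx_mul !trmxK.
by rewrite -scalemxAl mulmxDl linearZ/= mxtraceD !trO (gramC _ u)//; field.
Qed.

Lemma psd0 : psd (0 : 'M[R]_n).
Proof. by split=> [|u]; rewrite /symmx ?trmx0// mulmx0 mul0mx mxE. Qed.

Lemma psdD G H : psd G -> psd H -> psd (G + H).
Proof.
move=> [sG pG] [sH pH]; split; first by rewrite /symmx linearD/= sG sH.
by move=> u; rewrite mulmxDr mulmxDl mxE addr_ge0.
Qed.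

Lemma psdZ a G : 0 <= a -> psd G -> psd (a *: G).
Proof.
move=> a0 [sG pG]; split; first by rewrite /symmx linearZ/= sG.
by move=> u; rewrite -scalemxAr -scalemxAl mxE mulr_ge0.
Qed.

Lemma psd_outer v : psd (v *m v^T).
Proof.
split=> [|u]; first by rewrite /symmx trmx_mul trmxK.
by rewrite -/(gram _ u u) gram_outer -expr2 sqr_ge0.
Qed.

Lemma psd_gram G u : psd G -> 0 <= gram G u u.
Proof. by case=> _; exact. Qed.

Lemma psd_diag_ge0 G i : psd G -> 0 <= G i i.
Proof. by move=> pG; have := psd_gram _ (delta_mx i 0) pG; rewrite gram_delta. Qed.

(** Cauchy-Schwarz for a form that may be degenerate: the quadratic form is
    nonnegative on the plane spanned by the two vectors. *)
Lemma psd_gram_sqr G u v : psd G ->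
  gram G u v ^+ 2 <= gram G u u * gram G v v.
Proof.
move=> pG; have sG := pG.1.
have H s t := psd_gram _ (s *: u + t *: v) pG.
have E s t : gram G (s *: u + t *: v) (s *: u + t *: v) =
    s ^+ 2 * gram G u u + 2 * s * t * gram G u v + t ^+ 2 * gram G v v.
  by rewrite !gramlin (gramC _ v u sG); ring.
have {E} H s t : 0 <= s ^+ 2 * gram G u u + 2 * s * t * gram G u v
    + t ^+ 2 * gram G v v by rewrite -E.
have := psd_gram _ v pG.
move: (gram G u u) (gram G u v) (gram G v v) H => a b c H.
rewrite le_eqVlt => /orP[/eqP c0|c0].
  rewrite -c0 mulr0; have [->|b0] := eqVneq b 0; first by rewrite expr0n.
  (* this coefficient would make the form equal to - 1 *)
  have := H 1 (- (a + 1) / (2 * b)); rewrite -c0.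
  rewrite (_ : _ + _ = - 1); last by field.
  by rewrite lerNr oppr0 ler10.
have := H c (- b); rewrite (_ : _ + _ = c * (a * c - b ^+ 2)); last by ring.
by rewrite pmulr_rge0// subr_ge0.
Qed.

Lemma psd_norm_le_trace G i j : psd G -> `|G i j| <= \tr G.
Proof.
move=> pG.
have le k : G k k <= \tr G.
  rewrite /mxtrace (bigD1 k)//= lerDl sumr_ge0// => l _.
  exact: psd_diag_ge0.
have t0 : 0 <= \tr G by apply: le_trans (le i); exact: psd_diag_ge0.
rewrite -(ler_pXn2r (n := 2))// ?nnegrE// real_normK ?num_real//.
have := psd_gram_sqr _ (delta_mx i 0) (delta_mx j 0) pG.
rewrite !gram_delta => /le_trans; apply; rewrite expr2.
by apply: ler_pM => //; exact: psd_diag_ge0.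
Qed.

(** One step of a Cholesky factorisation: by Cauchy-Schwarz, the form keeps its
    sign after removal of the rank-one part carried by the vector i. *)
Lemma psd_peel G i : psd G -> 0 < G i i ->
  let v : 'cV_n := G *m delta_mx i 0 in
  psd (G - (G i i)^-1 *: (v *m v^T)).
Proof.
move=> pG i0 v; have sG := pG.1; split.
  by rewrite /symmx [_^T]raddfB/= [X in _ - X]linearZ/= trmx_mul trmxK sG.
move=> u; rewrite mulmxBr mulmxBl -scalemxAr -scalemxAl.
rewrite [X in 0 <= X]mxE [X in 0 <= _ + X]mxE [X in 0 <= _ - X]mxE.
rewrite -/(gram G u u) -/(gram (v *m v^T) u u) gram_outer subr_ge0.
have -> : dotv v u = gram G u (delta_mx i 0).
  by rewrite gramC// /dotv /v trmx_mul sG.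
rewrite ler_pdivrMl// mulrC -expr2.
by have := psd_gram_sqr _ u (delta_mx i 0) pG; rewrite gram_delta mulrC.
Qed.

(** Self-duality of the semidefinite cone.  Each peeled rank-one part v v^T
    contributes a value v^T W v of the other form, and peeling strictly decreases the
    number of nonzero diagonal entries; a positive semidefinite matrix with zero
    diagonal vanishes. *)
Lemma psd_trace_mul_ge0 W G : psd W -> psd G -> 0 <= \tr (W^T *m G).
Proof.
move=> pW; have [m] := ubnP #|[pred i | G i i != 0]|.
elim: m G => // m IH G lm pG.
have [/existsP[i Gi]|/existsPn G0] := boolP [exists i, G i i != 0]; last first.
  suff -> : G = 0 by rewrite mulmx0 mxtrace0.
  apply/matrixP => i j; rewrite mxE; apply/eqP.
  rewrite -sqrf_eq0 eq_le sqr_ge0 andbT.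
  have := psd_gram_sqr _ (delta_mx i 0) (delta_mx j 0) pG.
  by rewrite !gram_delta; move/negPn/eqP : (G0 i) => ->; rewrite mul0r.
have i0 : 0 < G i i by rewrite lt_neqAle eq_sym Gi psd_diag_ge0.
have /= := psd_peel _ _ pG i0; set v := G *m _; set G' := G - _ => pG'.
have vE j k : v j k = G j i by rewrite /v -colE mxE.
have G'E j : G' j j = G j j - (G i i)^-1 * G j i ^+ 2.
  by rewrite /G' mxE [in X in _ + X]mxE [in X in _ - X]mxE mxE big_ord1 [_^T _ _]mxE !vE.
have : 0 <= \tr (W^T *m G').
  apply: IH pG'; apply: leq_trans (lm : (_ <= m)%N); apply: proper_card.
  rewrite properE; apply/andP; split.
    apply/fintype.subsetP => j; rewrite !inE; apply: contraNN => /eqP Gj.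
    rewrite G'E Gj; have := psd_gram_sqr _ (delta_mx j 0) (delta_mx i 0) pG.
    rewrite !gram_delta Gj mul0r => H.
    have /eqP -> : G j i ^+ 2 == 0 by rewrite eq_le H sqr_ge0.
    by rewrite mulr0 subr0.
  apply/fintype.subsetPn; exists i; rewrite !inE// negbK G'E.
  by rewrite expr2 mulrA mulVf// mul1r subrr.
rewrite mulmxBr mxtraceD [\tr (- _)]raddfN/= subr_ge0 => /(le_trans _); apply.
rewrite -scalemxAr linearZ/= mulr_ge0 ?invr_ge0 ?(ltW i0)//.
rewrite mulmxA mxtrace_mulC mulmxA pW.1 /mxtrace big_ord1.
exact: psd_gram.
Qed.

End Psd.

(** * The pairing of lifted instances *)

Lemma sum_continuous {R : realType} {T : topologicalType} (I : finType)
    (f : I -> T -> R) :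
  (forall i, continuous (f i)) -> continuous (fun z => \sum_i f i z).
Proof.
move=> fc; apply: continuous_big => [|i _]; last exact: fc.
exact: add_continuous.
Qed.

Section Pairing.
Context {R : realType} {K : nat}.
Implicit Types U V W Z : gf_space R K.

Lemma pairingE U V : pairing U V =
  (\sum_i \sum_j U.1 i j * V.1 i j) + \sum_k U.2 k 0 * V.2 k 0.
Proof.
rewrite /pairing /dotv mxE; congr (_ + _).
  rewrite /mxtrace exchange_big; apply: eq_bigr => j _.
  by rewrite mxE; apply: eq_bigr => i _; rewrite mxE.
by apply: eq_bigr => i _; rewrite mxE.
Qed.

Lemma pairingC U V : pairing U V = pairing V U.
Proof.
rewrite !pairingE; congr (_ + _); last by apply: eq_bigr => i _; rewrite mulrC.
by apply: eq_bigr => i _; apply: eq_bigr => j _; rewrite mulrC.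
Qed.

Lemma pairingDl U V W : pairing (U + V) W = pairing U W + pairing V W.
Proof.
rewrite /pairing [in LHS]/= [_^T]raddfD/= mulmxDl mxtraceD addrACA.
by congr (_ + _); rewrite /dotv [_^T]raddfD/= mulmxDl mxE.
Qed.

Lemma pairingZl a U V : pairing (a *: U) V = a * pairing U V.
Proof.
rewrite /pairing /dotv [in LHS]/= ![(a *: _)^T]linearZ/= -!scalemxAl linearZ/=.
by rewrite mxE mulrDr.
Qed.

Lemma pairingNl U V : pairing (- U) V = - pairing U V.
Proof. by rewrite -scaleN1r pairingZl mulN1r. Qed.

Lemma pairing0l V : pairing 0 V = 0.
Proof. by rewrite -(scale0r 0) pairingZl mul0r. Qed.

Lemma pairing_suml (I : Type) (s : seq I) (P : pred I)
    (F : I -> gf_space R K) V :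
  pairing (\sum_(i <- s | P i) F i) V = \sum_(i <- s | P i) pairing (F i) V.
Proof.
apply: (big_ind2 (fun a b => pairing a V = b)) => //; first exact: pairing0l.
by move=> a b c d <- <-; rewrite pairingDl.
Qed.

Lemma pairingDr U V W : pairing W (U + V) = pairing W U + pairing W V.
Proof. by rewrite pairingC pairingDl !(pairingC _ W). Qed.

Lemma pairingZr a U V : pairing V (a *: U) = a * pairing V U.
Proof. by rewrite pairingC pairingZl (pairingC _ V). Qed.

Lemma pairingNr U V : pairing V (- U) = - pairing V U.
Proof. by rewrite pairingC pairingNl (pairingC _ V). Qed.

Lemma pairing_init Z : pairing (init_coef R K) Z = Z.1 ord0 ord0.
Proof.
rewrite pairingE /= [X in _ + X]big1 ?addr0 => [|k _]; last by rewrite mxE mul0r.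
rewrite (bigD1 ord0)//= (bigD1 ord0)//= mxE mul1r !big1 ?addr0// => i i0.
  by rewrite big1// => j _; rewrite mxE (negbTE i0) mul0r.
by rewrite mxE (negbTE i0) andbF mul0r.
Qed.

Lemma pairing_outer (u : 'cV[R]_K.+2) U : symmx U.1 ->
  pairing U (u *m u^T, 0) = gram U.1 u u.
Proof.
move=> sU; rewrite pairingC /pairing /dotv trmx0 mul0mx mxE addr0/=.
rewrite -trace_symouter// /symouter scalerDr -scalerDl.
by rewrite (_ : 2^-1 + 2^-1 = 1) ?scale1r//; field.
Qed.

Lemma pairing_value k U : pairing U (0, delta_mx k 0) = U.2 k 0.
Proof.
by rewrite pairingC /pairing /dotv/= trmx0 mul0mx mxtrace0 add0r trmx_delta -rowE mxE.
Qed.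

Lemma pairing_psd_ge0 U V : psd U.1 -> U.2 = 0 -> psd V.1 -> 0 <= pairing U V.
Proof.
move=> pU U2 pV; rewrite /pairing U2 /dotv trmx0 mul0mx mxE addr0.
exact: psd_trace_mul_ge0.
Qed.

(** Distances in the lifted set are measured entrywise: [gf_norm] bounds every
    entry, so a pairing is at most [gf_norm] of one side times this norm of the
    other. *)
Definition gf_norm1 U : R :=
  (\sum_i \sum_j `|U.1 i j|) + \sum_k `|U.2 k 0|.

Lemma gf_norm1_ge0 U : 0 <= gf_norm1 U.
Proof. by rewrite addr_ge0// sumr_ge0// => i _; rewrite sumr_ge0. Qed.

Lemma gf_norm1_le_add U V : gf_norm1 (U - V) <= gf_norm1 U + gf_norm1 V.
Proof.
rewrite /gf_norm1 addrACA -!big_split/= lerD//; last first.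
  by apply: ler_sum => k _; rewrite !mxE ler_normB.
apply: ler_sum => i _; rewrite -big_split/=.
by apply: ler_sum => j _; rewrite !mxE ler_normB.
Qed.

Lemma pairing_norm_le U V : `|pairing U V| <= gf_norm U * gf_norm1 V.
Proof.
have S0 : 0 <= \sum_i \sum_j U.1 i j ^+ 2.
  by rewrite sumr_ge0// => i _; rewrite sumr_ge0// => j _; exact: sqr_ge0.
have T0 : 0 <= \sum_k U.2 k 0 ^+ 2.
  by rewrite sumr_ge0// => i _; exact: sqr_ge0.
have sum_ge (I : finType) (f : I -> R) i :
    (forall j, 0 <= f j) -> f i <= \sum_j f j.
  by move=> f0; rewrite (bigD1 i)//= lerDl sumr_ge0.
have U1 i j : `|U.1 i j| <= gf_norm U.
  rewrite -sqrtr_sqr ler_wsqrtr// -[leLHS]addr0 lerD//.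
  apply: le_trans (sum_ge _ (fun i => \sum_j U.1 i j ^+ 2) i _).
    by apply: (sum_ge _ (fun j => U.1 i j ^+ 2)) => l; exact: sqr_ge0.
  by move=> l; rewrite sumr_ge0// => l' _; exact: sqr_ge0.
have U2 k : `|U.2 k 0| <= gf_norm U.
  rewrite -sqrtr_sqr ler_wsqrtr// -[leLHS]add0r lerD//.
  by apply: (sum_ge _ (fun k => U.2 k 0 ^+ 2)) => l; exact: sqr_ge0.
rewrite pairingE (le_trans (ler_normD _ _))// mulrDr lerD//.
  rewrite (le_trans (ler_norm_sum _ _ _))// mulr_sumr ler_sum// => i _.
  rewrite (le_trans (ler_norm_sum _ _ _))// mulr_sumr ler_sum// => j _.
  by rewrite normrM ler_wpM2r.
rewrite (le_trans (ler_norm_sum _ _ _))// mulr_sumr ler_sum// => i _.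
by rewrite normrM ler_wpM2r.
Qed.

Lemma gram_entry_continuous i j :
  continuous (fun Z : gf_space R K => Z.1 i j).
Proof.
move=> Z; apply: (@continuous_comp _ _ _ fst (fun G : 'M[R]_K.+2 => G i j)).
  exact: cvg_fst.
exact: coord_continuous.
Qed.

Lemma value_entry_continuous k : continuous (fun Z : gf_space R K => Z.2 k 0).
Proof.
move=> Z; apply: (@continuous_comp _ _ _ snd (fun F : 'cV[R]_K.+1 => F k 0)).
  exact: cvg_snd.
exact: coord_continuous.
Qed.

Lemma pairing_continuous (U : gf_space R K) : continuous (pairing U).
Proof.
have -> : pairing U = fun Z =>
    (\sum_i \sum_j U.1 i j * Z.1 i j) + \sum_k U.2 k 0 * Z.2 k 0.
  by apply/funext => Z; rewrite pairingE.
move=> Z; apply: continuousD; apply: sum_continuous => i.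
  apply: sum_continuous => j Z'; apply: continuousM; first exact: cst_continuous.
  exact: gram_entry_continuous.
move=> Z'; apply: continuousM; first exact: cst_continuous.
exact: value_entry_continuous.
Qed.

Lemma pairing_measurable U :
  measurable_fun setT (pairing U : borel_gf R K -> R).
Proof.
apply: (measurability _ (RGenOpens.measurableE R)).
move=> _ [_ [a [b ->] <-]]; rewrite setTI.
apply: sub_sigma_algebra.
by move/continuousP : (pairing_continuous U); apply; exact: interval_open.
Qed.

(** On the cone of pairs (G, F) with G positive semidefinite and F nonnegative,
    this linear form vanishes only at the origin; its level sets are the bases
    of that cone. *)
Definition pep_mass (Z : gf_space R K) : R := \tr Z.1 + \sum_k Z.2 k 0.

Lemma pep_mass_ge0 Z : psd Z.1 -> (forall k, 0 <= Z.2 k 0) -> 0 <= pep_mass Z.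
Proof.
move=> pZ F0; rewrite addr_ge0 ?sumr_ge0// => i _; exact: psd_diag_ge0.
Qed.

Lemma pep_mass_eq0 Z : psd Z.1 -> (forall k, 0 <= Z.2 k 0) ->
  pep_mass Z <= 0 -> Z = 0.
Proof.
case: Z => G F; rewrite /pep_mass /= => pG F0 m0.
have t0 : 0 <= \tr G by rewrite sumr_ge0// => i _; exact: psd_diag_ge0.
have s0 : 0 <= \sum_k F k 0 by rewrite sumr_ge0.
have t1 : \tr G = 0 by lra.
have s1 : \sum_k F k 0 = 0 by lra.
congr (_, _); apply/matrixP => i j; rewrite mxE; apply/eqP.
  by rewrite -normr_le0 -t1 psd_norm_le_trace.
by rewrite (ord1 j) (psumr_eq0P _ s1).
Qed.

Lemma pep_massZ a Z : pep_mass (a *: Z) = a * pep_mass Z.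
Proof.
rewrite /pep_mass/= mxtraceZ mulrDr; congr (_ + _).
by rewrite mulr_sumr; apply: eq_bigr => k _; rewrite mxE.
Qed.

Lemma pep_massD Z U : pep_mass (Z + U) = pep_mass Z + pep_mass U.
Proof.
rewrite /pep_mass mxtraceD addrACA; congr (_ + _).
by rewrite -big_split/=; apply: eq_bigr => k _; rewrite mxE.
Qed.

End Pairing.

(** * Interpolation conditions and boundedness *)

(** The curvature term of the interpolation inequality, in terms of a = |dg|^2,
    b = |dx|^2 and c = <dg, dx> for the differences dg of the gradients and dx of
    the points. *)
Definition interp_quad {R : realType} (mu L a b c : R) : R :=
  (2 * (1 - mu / L))^-1 * (L^-1 * a + mu * b - 2 * mu / L * c).

Section Interpolation.
Context {R : realType} {mu L : R} {K : nat} {eta : nat -> nat -> R}.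
Hypotheses (hmu : 0 <= mu) (hmuL : mu < L).
Implicit Types (Z : gf_space R K) (p q : pep_index K) (G : 'M[R]_K.+2).
Implicit Types (F : 'cV[R]_K.+1) (k : 'I_K.+1).

Local Notation g p := (gcoef R p).
Local Notation x p := (xcoef eta p).
Local Notation interp := (interp_coef mu L eta).

(** The form of G takes the place of the inner product of a Gram factor, so that
    the inequality can be read off any positive semidefinite matrix. *)
Lemma pairing_interp Z p q : symmx Z.1 ->
  pairing (interp p q) Z =
    gram Z.1 (g q) (x p - x q)
    + interp_quad mu L (gram Z.1 (g p - g q) (g p - g q))
        (gram Z.1 (x p - x q) (x p - x q)) (gram Z.1 (g q - g p) (x q - x p))
    + (dotv (fcoef R q) Z.2 - dotv (fcoef R p) Z.2).
Proof.
move=> sG; pose T A := \tr (A^T *m Z.1).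
have TD A B : T (A + B) = T A + T B by rewrite /T [_^T]raddfD/= mulmxDl raddfD.
have TZ a A : T (a *: A) = a * T A.
  by rewrite /T [_^T]linearZ/= -scalemxAl linearZ.
have TN A : T (- A) = - T A by rewrite -scaleN1r TZ mulN1r.
have TO u v : T (symouter u v) = gram Z.1 u v by exact: trace_symouter.
rewrite /pairing /interp_coef -/(T _); congr (_ + _); last first.
  by rewrite /dotv [_^T]raddfB/= mulmxBl !mxE.
by rewrite !(TD, TZ, TN, TO).
Qed.

Lemma symmx_interp (p q : pep_index K) : symmx (interp p q).1.
Proof.
apply: symmxD; first exact: symmx_symouter.
apply: symmxZ; apply: symmxD; last by apply/symmxN/symmxZ/symmx_symouter.
by apply: symmxD; apply/symmxZ/symmx_symouter.
Qed.

(** Without the initial condition the lifted set becomes a cone, on which every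
    bound scales with the initial distance. *)
Definition interp_cone (Z : gf_space R K) : Prop :=
  psd Z.1 /\
  forall m : pep_pairs K, pairing (interp (val m).1 (val m).2) Z <= 0.

Definition above_pair k : pep_pairs K := exist _ (Some k, None) isT.

Definition below_pair k : pep_pairs K := exist _ (None, Some k) isT.

Lemma interp_quadE a b c :
  interp_quad mu L a b c = (a + mu * L * b - 2 * mu * c) / (2 * (L - mu)).
Proof.
have L0 : L != 0 by rewrite gt_eqF// (le_lt_trans hmu).
by rewrite /interp_quad; field; rewrite L0 subr_eq0 gt_eqF.
Qed.

(** Up to a positive factor the curvature term is
    |u - mu v|^2 + mu (L - mu) |v|^2. *)
Lemma interp_quad_ge0 G u v : psd G ->
  0 <= interp_quad mu L (gram G u u) (gram G v v) (gram G u v).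
Proof.
move=> pG; rewrite interp_quadE divr_ge0 ?mulr_ge0 ?subr_ge0 ?(ltW hmuL)//.
have := psd_gram _ (u - mu *: v) pG; have := psd_gram _ v pG.
rewrite !gramlin (gramC _ v u pG.1) => v0 H.
have := mulr_ge0 (mulr_ge0 hmu v0) (_ : 0 <= L - mu).
by rewrite subr_ge0 ltW// => /(_ isT); lra.
Qed.

Lemma dotv_fcoef F p : dotv (fcoef R p) F = if p is Some k then F k 0 else 0.
Proof.
rewrite /dotv; case: p => [k|] /=; last by rewrite trmx0 mul0mx mxE.
by rewrite trmx_delta -rowE mxE.
Qed.

Lemma pairing_above Z k : symmx Z.1 ->
  pairing (interp (Some k) None) Z =
    interp_quad mu L (gram Z.1 (g (Some k)) (g (Some k)))
      (gram Z.1 (x (Some k)) (x (Some k))) (gram Z.1 (g (Some k)) (x (Some k)))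
    - Z.2 k 0.
Proof.
move=> sG; rewrite pairing_interp// !dotv_fcoef !subr0 !sub0r.
by rewrite gram0l add0r gramNl gramNr opprK.
Qed.

Lemma pairing_below Z k : symmx Z.1 ->
  pairing (interp None (Some k)) Z =
    interp_quad mu L (gram Z.1 (g (Some k)) (g (Some k)))
      (gram Z.1 (x (Some k)) (x (Some k))) (gram Z.1 (g (Some k)) (x (Some k)))
    - gram Z.1 (g (Some k)) (x (Some k)) + Z.2 k 0.
Proof.
move=> sG; rewrite pairing_interp// !dotv_fcoef !subr0 !sub0r.
rewrite !gramNr !gramNl !opprK; ring.
Qed.

Lemma psd_above (k : 'I_K.+1) : psd (interp (Some k) None).1.
Proof.
split=> [|u]; first exact: symmx_interp.
rewrite -/(gram _ u u) -pairing_outer; last exact: symmx_interp.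
have pu := psd_outer u.
rewrite pairing_above/=; last exact: pu.1.
by rewrite mxE subr0; exact: interp_quad_ge0.
Qed.

Lemma interp_cone_value_ge0 Z k : interp_cone Z -> 0 <= Z.2 k 0.
Proof.
move=> [pG H].
have := H (above_pair k); rewrite pairing_above; last exact: pG.1.
by have := interp_quad_ge0 _ (g (Some k)) (x (Some k)) pG; lra.
Qed.

(** The sum of the two inequalities between the iterate and the minimizer is the
    cocoercivity |g|^2 + mu L |x|^2 <= (mu + L) <g, x>; it gives
    |g|^2 <= 2 L <g, x>, and hence |g|^2 <= 4 L^2 |x|^2 by completing the
    square. *)
Lemma interp_cone_gradient_le Z k : interp_cone Z ->
  gram Z.1 (g (Some k)) (g (Some k)) <=
    4 * L ^+ 2 * gram Z.1 (x (Some k)) (x (Some k)).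
Proof.
move=> [pG H]; have sG := pG.1.
have L0 : 0 < L by apply: le_lt_trans hmuL.
have := H (above_pair k); have := H (below_pair k).
rewrite pairing_above// pairing_below//.
move: (g (Some k)) (x (Some k)) => u v.
have := psd_gram _ u pG; have := psd_gram _ v pG.
have := psd_gram _ ((1 / 2) *: u - L *: v) pG; rewrite interp_quadE.
rewrite !gramlin (gramC _ v u sG).
set a := gram _ u u; set b := gram _ v v; set c := gram _ u v.
set d := _ / (2 * (L - mu)) => h b0 a0 h1 h2.
have dE : d * (2 * (L - mu)) = a + mu * L * b - 2 * mu * c.
  by rewrite /d divfK// mulf_neq0// subr_eq0 gt_eqF.
have d2 : 2 * d <= c by lra.
have Lmu : 0 < L - mu by rewrite subr_gt0.
have : d * (2 * (L - mu)) <= c * (L - mu).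
  by rewrite mulrA (mulrC d) ler_pM2r.
rewrite dE => h3.
have mLb : 0 <= mu * L * b by rewrite !mulr_ge0// ltW.
have h4 : a <= (L + mu) * c by lra.
have Lmu' : 0 < L + mu by rewrite ltr_wpDr.
have c0 : 0 <= c by rewrite -(pmulr_rge0 _ Lmu'); lra.
have : (L + mu) * c <= 2 * L * c by apply: ler_wpM2r => //; have := hmuL; lra.
lra.
Qed.

Lemma interp_cone_value_le Z k : interp_cone Z ->
  Z.2 k 0 <= gram Z.1 (g (Some k)) (g (Some k)) + gram Z.1 (x (Some k)) (x (Some k)).
Proof.
move=> [pG H]; have sG := pG.1.
have := H (below_pair k); rewrite pairing_below//.
move: (g (Some k)) (x (Some k)) => u v.
have := interp_quad_ge0 _ u v pG.
have := psd_gram _ u pG; have := psd_gram _ v pG.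
have := psd_gram _ (u - v) pG.
by rewrite !gramlin (gramC _ v u sG); lra.
Qed.

(** The direction u has length at most a constant times the initial distance,
    uniformly over the cone.  Such directions form a linear space, so that
    boundedness passes from gradients to iterates without explicit
    constants. *)
Definition gram_bounded (u : 'cV[R]_K.+2) : Prop :=
  exists2 C, 0 <= C &
    forall Z, interp_cone Z -> gram Z.1 u u <= C * Z.1 ord0 ord0.

Lemma gram_bounded0 : gram_bounded 0.
Proof.
exists 0 => // Z _; by rewrite gram0l mul0r.
Qed.

Lemma gram_boundedD u v :
  gram_bounded u -> gram_bounded v -> gram_bounded (u + v).
Proof.
move=> [C C0 HC] [D D0 HD]; exists (2 * C + 2 * D).
  by rewrite addr_ge0// mulr_ge0.
move=> Z oZ; have [pG _] := oZ.
have := HC _ oZ; have := HD _ oZ; have := psd_gram _ (u - v) pG.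
by rewrite !gramlin (gramC _ v u pG.1); lra.
Qed.

Lemma gram_boundedZ a u : gram_bounded u -> gram_bounded (a *: u).
Proof.
move=> [C C0 HC]; exists (a ^+ 2 * C); first by rewrite mulr_ge0// sqr_ge0.
move=> Z /HC h; rewrite gramZl gramZr mulrA -expr2 -[leRHS]mulrA.
by rewrite ler_wpM2l// sqr_ge0.
Qed.

(** By strong induction: an iterate is a combination of the initial point and of
    the gradients at earlier iterates, and its own gradient is controlled by its
    position. *)
Lemma gram_bounded_iterate (p : pep_index K) :
  gram_bounded (x p) /\ gram_bounded (g p).
Proof.
case: p => [k|]; last by split; exact: gram_bounded0.
have [m] := ubnP k; elim: m k => // m IH k; rewrite ltnS => km.
have bx : gram_bounded (x (Some k)).
  apply: gram_boundedD.
    by exists 1 => // Z _; rewrite gram_delta mul1r.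
  rewrite -scaleN1r; apply: gram_boundedZ.
  apply: big_ind => [||l lk]; [exact: gram_bounded0|exact: gram_boundedD|].
  apply: big_ind => [||i il]; [exact: gram_bounded0|exact: gram_boundedD|].
  apply: gram_boundedZ; apply: (IH i _).2.
  exact: leq_ltn_trans il (leq_trans lk km).
split=> //; have [C C0 HC] := bx; exists (4 * L ^+ 2 * C).
  by rewrite mulr_ge0// mulr_ge0// sqr_ge0.
move=> Z oZ; rewrite (le_trans (interp_cone_gradient_le _ _ oZ))// -[leRHS]mulrA.
by rewrite ler_wpM2l ?HC// mulr_ge0// sqr_ge0.
Qed.

(** The bound is homogeneous in the initial distance.  It therefore gives
    boundedness of the lifted set, and also says that the only direction of the
    cone with zero initial distance is the zero one. *)
Lemma interp_cone_bounded : exists2 C, 0 <= C &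
  forall Z, interp_cone Z -> \tr Z.1 + \sum_k Z.2 k 0 <= C * Z.1 ord0 ord0.
Proof.
have sumB (I : finType) (f : gf_space R K -> I -> R) :
    (forall i, exists2 C, 0 <= C &
       forall Z, interp_cone Z -> f Z i <= C * Z.1 ord0 ord0) ->
    exists2 C, 0 <= C &
       forall Z, interp_cone Z -> \sum_i f Z i <= C * Z.1 ord0 ord0.
  move=> H; pose C i := sval (cid2 (H i)).
  have CP i : 0 <= C i /\
      forall Z, interp_cone Z -> f Z i <= C i * Z.1 ord0 ord0.
    by rewrite /C; case: cid2.
  exists (\sum_i C i); first by rewrite sumr_ge0// => i _; exact: (CP i).1.
  by move=> Z oZ; rewrite mulr_suml; apply: ler_sum => i _; exact: (CP i).2.
have [C C0 HC] : exists2 C, 0 <= C &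
    forall Z, interp_cone Z -> \tr Z.1 <= C * Z.1 ord0 ord0.
  apply: sumB => i; have [->|[k ->]] : i = ord0 \/ exists k, i = lift ord0 k.
  - by case: (unliftP ord0 i) => [k ->|->]; [right; exists k|left].
  - by exists 1 => // Z _; rewrite mul1r.
  - have [_ [C C0 HC]] := gram_bounded_iterate (Some k).
    by exists C => // Z /HC; rewrite /= gram_delta.
have [D D0 HD] : exists2 C, 0 <= C &
    forall Z, interp_cone Z -> \sum_k Z.2 k 0 <= C * Z.1 ord0 ord0.
  apply: (sumB _ (fun Z k => Z.2 k 0)) => k.
  have [[B B0 HB] [D D0 HD]] := gram_bounded_iterate (Some k).
  exists (D + B); first exact: addr_ge0.
  move=> Z oZ; rewrite (le_trans (interp_cone_value_le _ k oZ))// mulrDl lerD//.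
    exact: HD.
  exact: HB.
exists (C + D); first exact: addr_ge0.
by move=> Z oZ; rewrite mulrDl lerD// ?HC// HD.
Qed.

Lemma lifted_set_bounded r : exists2 D, 0 <= D &
  forall Z, lifted_set mu L eta r Z -> gf_norm1 Z <= D.
Proof.
have [C C0 HC] := interp_cone_bounded.
have B0 : 0 <= C * r ^+ 2 by rewrite mulr_ge0// sqr_ge0.
exists ((K.+2 * K.+2)%:R * (C * r ^+ 2) + C * r ^+ 2).
  by rewrite addr_ge0// mulr_ge0.
move=> Z [pZ oZ iZ]; have ok : interp_cone Z by [].
have F0 k : 0 <= Z.2 k 0 by exact: interp_cone_value_ge0.
have t0 : 0 <= \tr Z.1 by rewrite sumr_ge0// => i _; exact: psd_diag_ge0.
have s0 : 0 <= \sum_k Z.2 k 0 by rewrite sumr_ge0.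
have m : \tr Z.1 + \sum_k Z.2 k 0 <= C * r ^+ 2.
  apply: le_trans (HC _ ok) _; rewrite ler_wpM2l//.
  by move: iZ; rewrite pairing_init /init_cst; lra.
rewrite /gf_norm1 lerD//; last first.
  under eq_bigr do rewrite ger0_norm//; lra.
have -> : (K.+2 * K.+2)%:R * (C * r ^+ 2) =
    \sum_(i < K.+2) \sum_(j < K.+2) C * r ^+ 2.
  by rewrite sumr_const card_ord sumr_const card_ord -mulrnA mulr_natl.
apply: ler_sum => i _; apply: ler_sum => j _.
by rewrite (le_trans (psd_norm_le_trace _ _ _ pZ))//; lra.
Qed.

End Interpolation.

(** * A theorem of the alternative on compact convex sets *)

(** The squared positive part has a 2-Lipschitz derivative: it lies below its
    tangent plus the square of the increment. *)
Lemma sqr_posD {R : realType} (a d : R) :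
  Num.max (a + d) 0 ^+ 2 <= Num.max a 0 ^+ 2 + 2 * Num.max a 0 * d + d ^+ 2.
Proof.
by case: (leP a 0) => a0; case: (leP (a + d) 0) => b0; nra.
Qed.

(** Gordan's alternative.  The sum of the squared positive parts of the l_i attains
    its minimum on B, and the gradient of that sum at the minimum, which is the
    vector of positive parts up to a factor 2, is the required vector of weights:
    no segment into B decreases the sum to first order, so the weighted sum is
    nowhere smaller on B than at the minimum, where it is positive.  The third
    hypothesis is convexity of B and affinity of the l_i, expressed through the
    values of the l_i along segments. *)
Lemma compact_alternative {R : realType} {T : topologicalType} (B : set T)
    (I : finType) (l : I -> T -> R) :
  compact B -> (forall i, continuous (l i)) ->
  (forall z z' t, B z -> B z' -> 0 < t <= 1 ->
     exists2 z'', B z'' & forall i, l i z'' = l i z + t * (l i z' - l i z)) ->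
  (forall z, B z -> exists i, 0 < l i z) ->
  exists2 w : I -> R, (forall i, 0 <= w i) &
    forall z, B z -> 0 < \sum_i w i * l i z.
Proof.
move=> cB lc cvx sys; have [B0|B0] := pselect (B !=set0); last first.
  by exists (fun=> 0) => // z Bz; case: B0; exists z.
pose f z : R := \sum_i (Num.max (l i z) 0) ^+ 2.
have fc : continuous f.
  apply: sum_continuous => i z.
  apply: (@continuous_comp _ _ _ (fun z => Num.max (l i z) 0) (fun x => x ^+ 2)).
    apply: (continuous_max (f := l i) (g := cst 0)); first exact: lc.
    exact: cst_continuous.
  exact: exprn_continuous.
have [z0 /set_mem Bz0 minz0] := compact_EVT_min B0 cB (continuous_subspaceT fc).
pose w i := Num.max (l i z0) 0.
have w0 i : 0 <= w i by rewrite le_max lexx orbT.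
exists w => // z Bz.
pose d i := l i z - l i z0.
have step t : 0 < t <= 1 ->
    0 <= 2 * t * (\sum_i w i * d i) + t ^+ 2 * \sum_i d i ^+ 2.
  move=> t01; have [z' Bz' lz'] := cvx _ _ _ Bz0 Bz t01.
  have := minz0 z' (mem_set Bz'); rewrite -subr_ge0 => /le_trans; apply.
  rewrite /f -sumrB !mulr_sumr -big_split/=; apply: ler_sum => i _.
  by rewrite lz' lerBlDl (le_trans (sqr_posD _ _))// -/(w i) /d; lra.
have wd0 : 0 <= \sum_i w i * d i.
  have D0 : 0 <= \sum_i d i ^+ 2 by rewrite sumr_ge0// => i _; exact: sqr_ge0.
  (* otherwise a short step t would decrease f; this denominator keeps t in
     ]0, 1] and t * D at most - s *)
  move: (\sum_i _ * _) (\sum_i _ ^+ 2) step D0 => s D step D0.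
  rewrite leNgt; apply/negP => s0.
  have e : 0 < 1 - 2 * s + D by lra.
  have := step (- s / (1 - 2 * s + D)).
  have t0 : 0 < - s / (1 - 2 * s + D) by rewrite divr_gt0// oppr_gt0.
  have t1 : - s / (1 - 2 * s + D) <= 1 by rewrite ler_pdivrMr// mul1r; lra.
  rewrite t0 t1 => /(_ isT).
  have : - s / (1 - 2 * s + D) * (1 - 2 * s + D) = - s by rewrite divfK ?gt_eqF.
  move: (- s / _) t0 t1 => t t0 t1 tE; nra.
rewrite (_ : \sum_i w i * l i z = \sum_i w i * d i + \sum_i w i ^+ 2).
  rewrite ltr_wpDl// lt_neqAle sumr_ge0 ?andbT => [|i _]; last exact: sqr_ge0.
  have [i li] := sys _ Bz0; rewrite eq_sym psumr_neq0 => [|j _]; last exact: sqr_ge0.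
  apply/hasP; exists i; first exact: mem_index_enum.
  by rewrite exprn_gt0// /w lt_max li.
rewrite -big_split/=; apply: eq_bigr => i _; rewrite mulrBr.
have -> : w i ^+ 2 = w i * l i z0.
  by rewrite expr2 /w; case: leP; rewrite ?mul0r.
by rewrite subrK.
Qed.

(** * A compact base of the homogenised cone *)

Lemma vec_mx_continuous {R : realType} m n :
  continuous (@vec_mx R m n).
Proof.
move=> v s /nbhs_ballP[e e0 es]; apply/nbhs_ballP; exists e => // u [_ vu].
by apply: es; split=> // i j; rewrite !mxE; exact: vu.
Qed.

Lemma compact_mx_box {R : realType} m n :
  compact [set A : 'M[R]_(m, n) | forall i j, `|A i j| <= 1].
Proof.
have bc := @rV_compact R (m * n) (fun=> `[(-1), 1]%classic)
  (fun=> @segment_compact R (-1) 1).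
have := continuous_compact (continuous_subspaceT (vec_mx_continuous m n)) bc.
congr compact; apply/seteqP; split=> [A [v /= vb <-] i j|A /= Ab].
  by rewrite mxE; have := vb (mxvec_index i j); rewrite /= in_itv/= ler_norml.
exists (mxvec A); last exact: mxvecK.
move=> k /=; rewrite in_itv/= -ler_norml.
by case/mxvec_indexP: k => i j; rewrite mxvecE.
Qed.

Section PepBase.
Context {R : realType} {K : nat}.
Implicit Types Z : gf_space R K.
Local Notation hspace := (gf_space R K * R)%type.

(** The last component is the homogenising scale. *)
Definition pep_base : set hspace :=
  [set z : hspace | [/\ psd z.1.1, forall k, 0 <= z.1.2 k 0, 0 <= z.2
    & pep_mass z.1 + z.2 = 1]].

Lemma pep_base_norm Z (h : R) : psd Z.1 -> (forall k, 0 <= Z.2 k 0) -> 0 <= h ->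
  0 < pep_mass Z + h ->
  pep_base ((pep_mass Z + h)^-1 *: Z, (pep_mass Z + h)^-1 * h).
Proof.
move=> pZ F0 h0 s0; have si : 0 <= (pep_mass Z + h)^-1 by rewrite invr_ge0 ltW.
split=> [|k||] /=; first exact: psdZ.
- by rewrite mxE mulr_ge0.
- exact: mulr_ge0.
- by rewrite pep_massZ -mulrDr mulVf ?gt_eqF.
Qed.

Lemma continuous_fst_comp (f : gf_space R K -> R) :
  continuous f -> continuous (fun z : hspace => f z.1).
Proof.
move=> fc z; apply: (@continuous_comp _ _ _ fst f); first exact: cvg_fst.
exact: fc.
Qed.

(** The trace dominates every entry of a positive semidefinite matrix, so the
    base lies in a box. *)
Lemma pep_base_compact : compact pep_base.
Proof.
pose box : set hspace := ([set G : 'M[R]_K.+2 | forall i j, `|G i j| <= 1] `*`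
   [set F : 'cV[R]_K.+1 | forall i j, `|F i j| <= 1]) `*` `[0 : R, 1]%classic.
have cbox : compact box.
  apply: compact_setX; last exact: segment_compact.
  by apply: compact_setX; exact: compact_mx_box.
apply: (subclosed_compact _ cbox); last first.
  case=> -[G F] h [/= pG F0 h0]; rewrite /pep_mass/= => m1.
  have t0 : 0 <= \tr G by rewrite sumr_ge0// => i _; exact: psd_diag_ge0.
  have s0 : 0 <= \sum_k F k 0 by rewrite sumr_ge0.
  split=> /=; last by rewrite in_itv/= h0; lra.
  split=> i j; first by rewrite (le_trans (psd_norm_le_trace _ _ _ pG))//; lra.
  rewrite (ord1 j) ger0_norm//.
  have : F i 0 <= \sum_k F k 0 by rewrite (bigD1 i)//= lerDl sumr_ge0.
  lra.
have geC (f : hspace -> R) : continuous f -> closed [set z : hspace | 0 <= f z].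
  by move=> fc; exact: (continuous_closedP f).1 fc _ (@closed_ge R 0).
have eqC (f : hspace -> R) y : continuous f -> closed [set z : hspace | f z = y].
  by move=> fc; exact: (continuous_closedP f).1 fc _ (@closed_eq R y).
have sumC (f : hspace -> R) g :
    continuous f -> continuous g -> continuous (fun z => f z + g z).
  by move=> fc gc z; apply: continuousD; [exact: fc|exact: gc].
have -> : pep_base =
   (\bigcap_(ij in setT)
      [set z : hspace | z.1.1 ij.1 ij.2 - z.1.1 ij.2 ij.1 = 0]) `&`
   (\bigcap_(u in [set: 'cV[R]_K.+2])
      [set z : hspace | 0 <= pairing (u *m u^T, 0) z.1]) `&`
   (\bigcap_(k in setT) [set z : hspace | 0 <= z.1.2 k 0]) `&`
   [set z | 0 <= z.2] `&`
   [set z : hspace | \sum_i z.1.1 i i + \sum_k z.1.2 k 0 + z.2 = 1].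
  have gE u (Z : gf_space R K) : symmx Z.1 ->
      pairing (u *m u^T, 0) Z = gram Z.1 u u.
    by move=> sZ; rewrite pairingC pairing_outer.
  apply/seteqP; split=> z.
    case=> -[sG pG] F0 h0 m1; split=> //; split=> //.
    split; last by move=> k _; exact: F0.
    split.
      by move=> [i j] _ /=; rewrite -{1}sG mxE subrr.
    by move=> u _ /=; rewrite gE//; exact: pG.
  case=> -[[[sG pG] F0] h0] m1.
  have sz : symmx z.1.1.
    by apply/matrixP => i j; rewrite mxE; apply/eqP; rewrite -subr_eq0 (sG (j, i)).
  split=> //; last by move=> k; exact: F0.
  by split=> // u; have := pG u I; rewrite /= gE.
have sndc : continuous (fun z : hspace => z.2) by move=> z; exact: cvg_snd.
have Gc i j := continuous_fst_comp _ (gram_entry_continuous i j).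
have Fc k := continuous_fst_comp _ (value_entry_continuous k).
apply: closedI; last first.
  by apply: eqC; apply: (sumC _ _) => //; apply: sumC; apply: sum_continuous.
apply: closedI; last exact: geC.
apply: closedI; last by apply: closed_bigI => k _; apply: geC.
apply: closedI; last first.
  apply: closed_bigI => u _; apply: geC.
  exact/continuous_fst_comp/pairing_continuous.
by apply: closed_bigI => ij _; apply: eqC => z; apply: continuousB; exact: Gc.
Qed.

End PepBase.

(** * Strong duality for the performance estimation problem *)

Section Duality.
Context {R : realType} {mu L : R} {K : nat} {eta : nat -> nat -> R} {r : R}.
Hypotheses (hmu : 0 <= mu) (hmuL : mu < L).
Implicit Types Z U C : gf_space R K.
Local Notation interp := (interp_coef mu L eta).
Local Notation interp_pair m := (interp (val m).1 (val m).2).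
Local Notation interp_cone := (@interp_cone R mu L K eta).

Lemma lifted_set_scale Z a : 0 < a -> interp_cone Z ->
  pairing (init_coef R K) Z <= r ^+ 2 * a -> lifted_set mu L eta r (a^-1 *: Z).
Proof.
move=> a0 [pZ oZ] iZ; split=> [|m|].
- by apply: psdZ => //; rewrite invr_ge0 ltW.
- by rewrite pairingZr mulr_ge0_le0// invr_ge0 ltW.
- by rewrite pairingZr /init_cst subr_le0 mulrC ler_pdivrMr.
Qed.

(** For positive scale the point rescales into the lifted set.  Zero scale is
    impossible on the base, because the initial distance and with it the whole
    mass would vanish. *)
Lemma interp_cone_pairing_lt C gamma z :
  (forall Z, lifted_set mu L eta r Z -> pairing C Z < gamma) ->
  pep_base z -> interp_cone z.1 ->
  pairing (init_coef R K) z.1 <= r ^+ 2 * z.2 ->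
  pairing C z.1 < gamma * z.2.
Proof.
move=> Cg [pz F0 z0 m1] oz iz; have [z2|z2] := eqVneq z.2 0.
  have [D D0 HD] := interp_cone_bounded (K := K) (eta := eta) hmu hmuL.
  have := HD _ oz; rewrite -/(pep_mass z.1) -pairing_init.
  move: iz m1; rewrite z2 mulr0 addr0 => iz -> h.
  have : D * pairing (init_coef R K) z.1 <= 0 by rewrite mulr_ge0_le0.
  by move: h; lra.
have zp : 0 < z.2 by rewrite lt_neqAle eq_sym z2.
have /Cg := lifted_set_scale _ _ zp oz iz.
by rewrite pairingZr mulrC ltr_pdivrMr.
Qed.

(** Multipliers certifying that gamma bounds the objective C on the lifted
    set. *)
Definition pep_dual (C : gf_space R K) (gamma : R) (y : pep_pairs K -> R)
    (tau : R) : Prop :=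
  let W := \sum_(m : pep_pairs K) y m *: interp_pair m
           + tau *: init_coef R K - C in
  [/\ 0 <= tau, forall m, 0 <= y m, psd W.1, W.2 = 0 & r ^+ 2 * tau <= gamma].

(** Duality for nonnegative values F: the positivity of F is built into the cone, so
    the linear part of the certificate is only nonnegative. *)
Lemma pep_dual_relaxed C gamma Z0 : symmx C.1 -> lifted_set mu L eta r Z0 ->
  (forall Z, lifted_set mu L eta r Z -> pairing C Z < gamma) ->
  exists y tau, let W := \sum_(m : pep_pairs K) y m *: interp_pair m
           + tau *: init_coef R K - C in
  [/\ 0 <= tau, forall m, 0 <= y m, psd W.1, forall k, 0 <= W.2 k 0
    & r ^+ 2 * tau <= gamma].
Proof.
move=> sC lZ0 Cg.
pose U (i : pep_pairs K + bool) : gf_space R K :=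
  match i with
  | inl m => interp_pair m
  | inr true => init_coef R K
  | inr false => - C
  end.
(* the coefficient of the scale in condition i *)
pose c (i : pep_pairs K + bool) : R :=
  match i with
  | inl m => 0
  | inr true => - r ^+ 2
  | inr false => gamma
  end.
pose l i (z : gf_space R K * R) := pairing (U i) z.1 + c i * z.2.
have lc i : continuous (l i).
  move=> z; apply: (@continuousD _ _ _ (fun z => pairing (U i) z.1)
    (fun z => c i * z.2)).
    exact/continuous_fst_comp/pairing_continuous.
  apply: (@continuousM _ _ (fun=> c i) (fun z : gf_space R K * R => z.2)).
    exact: cst_continuous.
  exact: cvg_snd.
have cvx z z' t : pep_base z -> pep_base z' -> 0 < t <= 1 ->
    exists2 z'', pep_base z'' & forall i, l i z'' = l i z + t * (l i z' - l i z).
  move=> [pz F0 z0 m1] [pz' F0' z0' m1'] /andP[t0 t1].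
  have t1' : 0 <= 1 - t by rewrite subr_ge0.
  have {}t0 := ltW t0.
  exists ((1 - t) *: z.1 + t *: z'.1, (1 - t) * z.2 + t * z'.2); last first.
    by move=> i; rewrite /l /= pairingDr !pairingZr; ring.
  split=> [|k||] /=.
  - by apply: psdD; exact: psdZ.
  - by rewrite !mxE addr_ge0 ?mulr_ge0.
  - by rewrite addr_ge0 ?mulr_ge0.
  - rewrite pep_massD !pep_massZ.
    transitivity ((1 - t) * (pep_mass z.1 + z.2) + t * (pep_mass z'.1 + z'.2)).
      by ring.
    by rewrite m1 m1'; ring.
have sys z : pep_base z -> exists i, 0 < l i z.
  move=> bz; apply/not_existsP => H.
  have {}H i : l i z <= 0 by rewrite leNgt; apply/negP => /H.
  have oz : interp_cone z.1.
    split=> [|m]; first by case: bz.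
    by have := H (inl m); rewrite /l/= mul0r addr0.
  have iz : pairing (init_coef R K) z.1 <= r ^+ 2 * z.2.
    by have := H (inr true); rewrite /l/= mulNr subr_le0.
  have := interp_cone_pairing_lt _ _ _ Cg bz oz iz.
  by have := H (inr false); rewrite /l/= pairingNl; lra.
have [w w0 wpos] := compact_alternative _ _ _ pep_base_compact lc cvx sys.
have wE z : \sum_i w i * l i z =
   pairing (\sum_m w (inl m) *: interp_pair m + w (inr true) *: init_coef R K
            - w (inr false) *: C) z.1
   + (gamma * w (inr false) - r ^+ 2 * w (inr true)) * z.2.
  rewrite big_sumType big_bool /l/= !pairingDl !pairingNl pairing_suml.
  rewrite (pairingZl _ C) (pairingZl _ (init_coef R K)).
  move: (pairing (init_coef R K) z.1) (pairing C z.1) => a b.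
  rewrite -!addrA; congr (_ + _).
    by apply: eq_bigr => m _; rewrite pairingZl mul0r addr0.
  by ring.
(* the slack of the certificate, before division by the weight of C *)
set V := _ - _ *: C in wE.
have V0 Z a : psd Z.1 -> (forall k, 0 <= Z.2 k 0) -> 0 <= a -> 0 < pep_mass Z + a ->
    0 < pairing V Z + (gamma * w (inr false) - r ^+ 2 * w (inr true)) * a.
  move=> pZ F0 a0 s0; have := wpos _ (pep_base_norm _ _ pZ F0 a0 s0).
  rewrite wE/= pairingZr mulrCA -mulrDr pmulr_rgt0 ?invr_gt0//.
(* otherwise the weighted sum is nonpositive at Z0 with scale 1 *)
have h0 : 0 < w (inr false).
  rewrite lt_neqAle w0 andbT; apply/negP => /eqP h0.
  have [pZ0 oZ0 iZ0] := lZ0.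
  have F0 k : 0 <= Z0.2 k 0.
    exact: (interp_cone_value_ge0 hmu hmuL Z0 k (conj pZ0 oZ0)).
  have := V0 Z0 1 pZ0 F0 ler01 (ltr_wpDl (pep_mass_ge0 _ pZ0 F0) ltr01).
  rewrite /V -h0 scale0r subr0 pairingDl pairing_suml pairingZl mulr0 sub0r mulr1.
  apply/negP; rewrite -leNgt -addrA.
  rewrite (_ : _ - _ = w (inr true) *
      (pairing (init_coef R K) Z0 + init_cst r)); last by rewrite /init_cst; ring.
  rewrite -[leRHS]addr0 lerD//; last exact: mulr_ge0_le0.
  by rewrite sumr_le0// => m _; rewrite pairingZl mulr_ge0_le0.
have hi : 0 <= (w (inr false))^-1 by rewrite invr_ge0 ltW.
exists (fun m => (w (inr false))^-1 * w (inl m)).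
exists ((w (inr false))^-1 * w (inr true)).
have -> : \sum_m ((w (inr false))^-1 * w (inl m)) *: interp_pair m
    + ((w (inr false))^-1 * w (inr true)) *: init_coef R K - C =
    (w (inr false))^-1 *: V.
  rewrite /V scalerBr scalerDr !scalerA mulVf ?gt_eqF// scale1r scaler_sumr.
  by congr (_ + _ - _); apply: eq_bigr => m _; rewrite scalerA.
have sV : symmx V.1.
  apply: symmxD; last by apply/symmxN/symmxZ.
  apply: symmxD; last first.
    by apply: symmxZ; rewrite /symmx trmx_delta.
  apply: (big_ind (fun U : gf_space R K => symmx U.1)) => [|U1 U2|m _].
  - by rewrite /symmx trmx0.
  - exact: symmxD.
  - by apply: symmxZ; exact: symmx_interp.
have Vge0 Z : psd Z.1 -> (forall k, 0 <= Z.2 k 0) -> 0 <= pairing V Z.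
  move=> pZ F0; have [m0|m0] := ltP 0 (pep_mass Z).
    have := V0 Z 0 pZ F0 (lexx 0); rewrite addr0 mulr0 addr0 => /(_ m0).
    exact: ltW.
  by rewrite (pep_mass_eq0 _ pZ F0 m0) pairingC pairing0l.
split=> [|m||k|]; rewrite ?mulr_ge0//.
- apply: psdZ => //; split=> // u; rewrite -/(gram _ u u) -pairing_outer//.
  by apply: Vge0 => [|k]; [exact: psd_outer|rewrite mxE].
- rewrite [leRHS]mxE mulr_ge0// -pairing_value; apply: Vge0 => [|k'] /=.
    exact: psd0.
  by rewrite mxE; case: (k' == k).
- (* the pure scale direction *)
  have := V0 0 1; rewrite pairingC pairing0l add0r mulr1 => H.
  rewrite mulrCA ler_pdivrMl// [leRHS]mulrC -subr_ge0; apply/ltW/H => //.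
  - exact: psd0.
  - by move=> k; rewrite mxE.
  - rewrite ltr_wpDl// pep_mass_ge0 => // [|k]; last by rewrite mxE.
    exact: psd0.
Qed.

Lemma pep_dual0 : pep_dual 0 0 (fun=> 0) 0.
Proof.
have W0 : \sum_(m : pep_pairs K) 0 *: interp_pair m + 0 *: init_coef R K - 0 = 0.
  by rewrite big1 => [|m _]; rewrite scale0r ?subr0 ?addr0.
by split=> //; rewrite ?W0 ?mulr0//; exact: psd0.
Qed.

(** The inequality between iterate k and the minimizer has - e_k as its linear
    part and a positive semidefinite matrix part.  Raising its multiplier by the
    k-th entry of the linear slack cancels that slack and keeps the matrix part
    positive semidefinite. *)
Lemma pep_strong_duality C gamma Z0 : symmx C.1 -> lifted_set mu L eta r Z0 ->
  (forall Z, lifted_set mu L eta r Z -> pairing C Z < gamma) ->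
  exists y tau, pep_dual C gamma y tau.
Proof.
move=> sC lZ0 Cg; have [y [tau []]] := pep_dual_relaxed _ _ _ sC lZ0 Cg.
move eW : (_ - C) => W tau0 y0 pW W0 tg.
exists (fun m => y m + \sum_k W.2 k 0 * (m == above_pair k)%:R), tau.
have select (e : 'I_K.+1 -> R) :
    \sum_m (\sum_k e k * (m == above_pair k)%:R) *: interp_pair m =
    \sum_k e k *: interp (Some k) None.
  under eq_bigr do rewrite scaler_suml.
  rewrite exchange_big; apply: eq_bigr => k _.
  rewrite (bigD1 (above_pair k))// eqxx mulr1 big1 => [|m /andP[_ mk]].
    exact: addr0.
  by rewrite (negbTE mk) mulr0 scale0r.
have WE : \sum_m (y m + \sum_k W.2 k 0 * (m == above_pair k)%:R) *: interp_pair m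
    + tau *: init_coef R K - C = W + \sum_k W.2 k 0 *: interp (Some k) None.
  under eq_bigr do rewrite scalerDl.
  rewrite big_split/= select; set S := \sum_(k < _) _.
  by rewrite -eW (addrAC _ S) (addrAC _ S).
split=> [//|m|||//].
- rewrite addr_ge0// sumr_ge0// => k _; rewrite mulr_ge0//.
- rewrite WE; apply: psdD => //.
  apply: (big_ind (fun U : gf_space R K => psd U.1)) => [|U1 U2|k _].
  + exact: psd0.
  + exact: psdD.
  + by apply: psdZ => //; exact: psd_above.
- rewrite WE; apply/matrixP => i j; rewrite (ord1 j) !mxE.
  have -> : (\sum_k W.2 k 0 *: interp (Some k) None).2 i 0 =
            \sum_k (W.2 k 0 *: interp (Some k) None).2 i 0.
    by apply: (big_morph (fun U : gf_space R K => U.2 i 0)) => [U1 U2|]; rewrite mxE.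
  rewrite (bigD1 i)//= big1 => [|k ki]; rewrite !mxE ?eqxx.
    by rewrite addr0 sub0r mulrN1 subrr.
  by rewrite eq_sym (negbTE ki) oppr0 addr0 mulr0.
Qed.

End Duality.

(** * Bounds on the value of the distributionally robust problem *)

Section DRO.
Context {R : realType} {mu L : R} {K : nat} {eta : nat -> nat -> R} {r : R}.
Context {N : nat} (N0 : (0 < N)%N) {Zhat : 'I_N -> gf_space R K}.
Hypothesis hZhat : forall i, lifted_set mu L eta r (Zhat i).
Context {J : nat} (obj : 'I_J -> gf_space R K) (cobj : 'I_J -> R).
Implicit Types (Z : gf_space R K) (v : dro_var R K N J).
Local Notation feasible := (dro_feasible mu L eta r Zhat obj cobj).
Local Notation pep := (dro_pep mu L eta r Zhat obj cobj).

(** Weak duality: the slack matrix and Z.1 are positive semidefinite, hence pair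
    nonnegatively, and the multiplied constraints are nonpositive at Z. *)
Lemma dro_feasible_bound eps v Z i j :
  feasible eps v -> lifted_set mu L eta r Z ->
  cobj j * dv_t v + pairing (obj j) Z + pairing (dv_XY v i j) (Z - Zhat i)
    + dv_lambda v * eps <= dv_s v i.
Proof.
move=> [l0 /(_ i j)] [[tau0 y0 _] sv [pW W2] _] [pZ oZ iZ].
have := pairing_psd_ge0 _ Z pW W2 pZ.
rewrite pairingDl pairingDl pairingDl pairing_suml !pairingNl pairingZl.
have y_le : \sum_(m : pep_pairs K)
    pairing (dv_y v i j m *: interp_coef mu L eta (val m).1 (val m).2) Z <= 0.
  by rewrite sumr_le0// => m _; rewrite pairingZl mulr_ge0_le0.
have tau_le : dv_tau v i j * pairing (init_coef R K) Z <= dv_tau v i j * r ^+ 2.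
  by rewrite ler_wpM2l// -subr_le0.
rewrite pairingDr pairingNr; move: sv y_le tau_le; rewrite /init_cst.
lra.
Qed.

Lemma dro_feasible_sample eps v i j : 0 <= eps -> feasible eps v ->
  cobj j * dv_t v + pairing (obj j) (Zhat i) <= dv_s v i.
Proof.
move=> eps0 fv; have := dro_feasible_bound _ _ _ i j fv (hZhat i).
rewrite subrr (pairingC _ 0) pairing0l addr0.
have : 0 <= dv_lambda v * eps by rewrite mulr_ge0//; case: fv.
lra.
Qed.

Lemma dro_feasible_worst eps v Z i j : gf_norm1 (Z - Zhat i) <= eps ->
  feasible eps v -> lifted_set mu L eta r Z ->
  cobj j * dv_t v + pairing (obj j) Z <= dv_s v i.
Proof.
move=> Ze fv lZ; have := dro_feasible_bound _ _ _ i j fv lZ.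
have [l0 /(_ i j) [_ _ _ nl]] := fv.
have : `|pairing (dv_XY v i j) (Z - Zhat i)| <= dv_lambda v * eps.
  apply: le_trans (pairing_norm_le _ _) _; rewrite ler_pM//.
    exact: sqrtr_ge0.
  exact: gf_norm1_ge0.
by rewrite ler_norml => /andP[]; lra.
Qed.

(** With XY = - obj the slack matrix vanishes and the objective is evaluated at
    the samples themselves, at a price of lambda eps. *)
Lemma dro_pep_le_transport eps t lam (s : 'I_N -> R) :
  0 <= lam -> (forall j, symmx (obj j).1) ->
  (forall j, gf_norm (- obj j) <= lam) ->
  (forall i j, cobj j * t + pairing (obj j) (Zhat i) + lam * eps <= s i) ->
  (pep eps <= (N%:R^-1 * \sum_i s i)%:E)%E.
Proof.
move=> l0 so no hs; apply: ereal_inf_lbound.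
have W0 j : \sum_(m : pep_pairs K) 0 *: interp_coef mu L eta (val m).1 (val m).2
    - (- obj j) + 0 *: init_coef R K - obj j = 0.
  rewrite big1 => [|m _]; last exact: scale0r.
  by rewrite scale0r addr0 sub0r opprK subrr.
have p0 : psd (0 : gf_space R K).1 /\ (0 : gf_space R K).2 = 0.
  by split=> //; exact: psd0.
exists (DROVar s t (fun _ _ => 0) (fun _ j => - obj j) lam (fun _ _ _ => 0)) => //.
split=> // i j; split.
- by split=> //; exact: symmxN.
- by rewrite /= mulr0 subr0 pairingNl opprK.
- exact: (eq_ind_r (fun W : gf_space R K => psd W.1 /\ W.2 = 0) p0 (W0 j)).
- exact: no.
Qed.

(** With XY = 0 the radius disappears from the constraints, which separate
    into one performance estimation dual for each piece of the objective. *)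
Lemma dro_pep_le_dual eps t s (gam : 'I_J -> R) :
  (forall j, exists y tau, @pep_dual R mu L K eta r (obj j) (gam j) y tau) ->
  (forall j, cobj j * t + gam j <= s) ->
  (pep eps <= s%:E)%E.
Proof.
move=> dual hs; apply: ereal_inf_lbound.
pose y j := projT1 (cid (dual j)).
pose tau j := projT1 (cid (projT2 (cid (dual j)))).
have yP j : @pep_dual R mu L K eta r (obj j) (gam j) (y j) (tau j).
  by rewrite /y /tau; case: cid => y' e /=; case: cid.
exists (DROVar (fun=> s) t (fun _ => tau) (fun _ _ => 0) 0 (fun _ => y)).
  split=> // i j; have [tau0 y0 pW W2 tg] := yP j; split.
  - by split=> //; rewrite /symmx trmx0.
  - by rewrite /= pairing0l mul0r subr0 addr0 /init_cst; have := hs j; lra.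
  - by rewrite [X in psd (X + _ - _).1]subr0 [X in (X + _ - _).2]subr0; split.
  - rewrite /gf_norm/= big1 => [|i' _].
    2: by rewrite big1// => j' _; rewrite mxE expr0n.
    by rewrite big1 ?addr0 ?sqrtr0// => k _; rewrite mxE expr0n.
rewrite /dro_objective/= sumr_const card_ord -[s *+ N]mulr_natl mulKf//.
by rewrite pnatr_eq0 -lt0n.
Qed.

Lemma dro_pep_ge eps (a : R) :
  (forall v, feasible eps v -> a <= dro_objective v) -> (a%:E <= pep eps)%E.
Proof.
by move=> H; apply: le_ereal_inf_tmp => _ [v fv <-]; rewrite lee_fin H.
Qed.

Lemma dro_objective_ge v (a : 'I_N -> R) : (forall i, a i <= dv_s v i) ->
  N%:R^-1 * \sum_i a i <= dro_objective v.
Proof. by move=> H; rewrite ler_wpM2l ?invr_ge0// ler_sum. Qed.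

End DRO.

(** * Conditional value-at-risk of an empirical distribution *)

Section EmpiricalCVaR.
Context {R : realType}.

Lemma expectation_empirical d (T : measurableType d) (N : nat)
    (hN : (0 < N)%N) (z : 'I_N -> T) (f : T -> R) :
  measurable_fun setT f -> (forall w, 0 <= f w) ->
  ('E_(empirical z hN)[f])%E = (N%:R^-1 * \sum_(i < N) f (z i))%:E.
Proof.
move=> mf f0; rewrite unlock.
have N_ge0 : (0 <= N%:R^-1 :> R) by rewrite invr_ge0.
pose m := msum (R := R) (fun k => \d_(z (odflt (Ordinal hN) (insub k)))) N.
rewrite (eq_measure_integral (mscale (NngNum N_ge0) m)); last first.
  move=> A _ _; rewrite /empirical /mscale /m /msum/=; congr (_ * _)%E.
  by apply: eq_bigr => i _; rewrite valK.
have /measurable_EFinP mf' := mf.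
rewrite ge0_integral_mscale//; last by move=> w _; rewrite lee_fin.
rewrite ge0_integral_measure_sum//; last by move=> w _; rewrite lee_fin.
rewrite EFinM -sumEFin; congr (_ * _)%E; apply: eq_bigr => i _.
by rewrite integral_dirac// diracT mul1e valK.
Qed.

Definition cvar_objective (N : nat) (alpha t : R) (x : 'I_N -> R) : R :=
  t + alpha^-1 * (N%:R^-1 * \sum_i Num.max (x i - t) 0).

Lemma CVaR_empirical (K N : nat) (hN : (0 < N)%N) (z : 'I_N -> gf_space R K)
    alpha (U : gf_space R K) :
  CVaR (empirical (z : 'I_N -> borel_gf R K) hN) alpha (pairing U) =
  ereal_inf [set (cvar_objective N alpha t (fun i => pairing U (z i)))%:E
            | t in [set: R]].
Proof.
rewrite /CVaR; congr ereal_inf; apply: eq_imagel => t _.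
rewrite expectation_empirical//; last by move=> w; rewrite le_max lexx orbT.
apply: measurable_maxr; last exact: measurable_cst.
apply: measurable_funB; last exact: measurable_cst.
exact: pairing_measurable.
Qed.

End EmpiricalCVaR.

(** * The two regimes of the radius *)

Lemma cvge_linear_squeeze {R : realType} (f : R -> \bar R) (l : \bar R) (c : R) :
  (forall e, 0 < e -> (l <= f e <= l + (c * e)%:E)%E) ->
  f e @[e --> 0^'+] --> l.
Proof.
move=> H; apply: (@squeeze_cvge _ _ _ _ (cst l) _ (fun e => l + (c * e)%:E)%E).
- by near=> e; apply: H.
- exact: cvg_cst.
- rewrite -[X in _ --> X]adde0; apply: cvgeD.
  + exact: fin_num_adde_defl.
  + exact: cvg_cst.
  + apply: cvg_EFin; first by near=> e.
    apply: cvg_at_right_filter; rewrite -[X in _ --> X](mulr0 c).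
    by apply: cvgM; [exact: cvg_cst|exact: cvg_id].
Unshelve. all: by end_near. Qed.

Section OptimalValues.
Context {R : realType} {mu L : R} {K : nat} {eta : nat -> nat -> R} {r : R}.
Hypotheses (hmu : 0 <= mu) (hmuL : mu < L).
Context {N : nat} (N0 : (0 < N)%N) {Zhat : 'I_N -> gf_space R K}.
Hypothesis hZhat : forall i, lifted_set mu L eta r (Zhat i).
Context {Aobj : 'M[R]_K.+2} (hAobj : symmx Aobj) {bobj : 'cV[R]_K.+1}.
Context {alpha : R} (halpha0 : 0 < alpha) (halpha1 : alpha <= 1).

Local Notation phi := (pairing (Aobj, bobj)).
Local Notation vE := (dro_pep_expectation mu L eta r Zhat Aobj bobj).
Local Notation vC := (dro_pep_cvar mu L eta r Zhat Aobj bobj alpha).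
Local Notation worst :=
  (ereal_sup [set (phi Z)%:E | Z in lifted_set mu L eta r]).
Local Notation cvar := (ereal_inf [set
  (cvar_objective N alpha t (fun i => phi (Zhat i)))%:E | t in [set: R]]).
Local Notation avg := (N%:R^-1 * \sum_(i < N) phi (Zhat i)).

Lemma avg_cst c : N%:R^-1 * \sum_(i < N) c = c :> R.
Proof.
by rewrite sumr_const card_ord -[c *+ N]mulr_natl mulKf// pnatr_eq0 -lt0n.
Qed.

Lemma avg_add (x : 'I_N -> R) c :
  N%:R^-1 * \sum_i (x i + c) = N%:R^-1 * (\sum_i x i) + c.
Proof.
by rewrite big_split mulrDr avg_cst.
Qed.

(** The first piece of the CVaR objective; its maximum with the second piece t is
    t + alpha^-1 max(x - t, 0). *)
Lemma cvar_pieceE t x : alpha^-1 * (alpha - 1) * t + alpha^-1 * x =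
  t + alpha^-1 * (x - t).
Proof. by field; rewrite gt_eqF. Qed.

Lemma expectation_near_sample eps : 0 < eps ->
  (avg%:E <= vE eps <= avg%:E + (gf_norm (- (Aobj, bobj)) * eps)%:E)%E.
Proof.
move=> e0; apply/andP; split.
  apply: dro_pep_ge => v fv; apply: dro_objective_ge => i.
  have := dro_feasible_sample hZhat _ _ _ v i ord0 (ltW e0) fv.
  by rewrite mul0r add0r.
rewrite -EFinD -avg_add.
apply: (dro_pep_le_transport _ _ _ 0 (gf_norm (- (Aobj, bobj)))) => // [|i j].
  exact: sqrtr_ge0.
by rewrite mul0r add0r.
Qed.

Lemma cvar_near_sample : exists c : R, forall eps, 0 < eps ->
  (cvar <= vC eps <= cvar + (c * eps)%:E)%E.
Proof.
pose obj (j : 'I_2) : gf_space R K :=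
  if j == ord0 then alpha^-1 *: (Aobj, bobj) else (0, 0).
pose c := \sum_j gf_norm (- obj j).
have n0 j : 0 <= gf_norm (- obj j) by exact: sqrtr_ge0.
exists c => eps e0; apply/andP; split.
  apply: le_ereal_inf_tmp => _ [v fv <-].
  apply: (@le_trans _ _ (cvar_objective N alpha (dv_t v) (fun i => phi (Zhat i)))%:E).
    by apply: ereal_inf_lbound; exists (dv_t v).
  rewrite lee_fin /cvar_objective mulrCA addrC mulr_sumr -avg_add.
  apply: dro_objective_ge => i.
  have h0 := dro_feasible_sample hZhat _ _ _ v i ord0 (ltW e0) fv.
  have h1 := dro_feasible_sample hZhat _ _ _ v i ord_max (ltW e0) fv.
  move: h0 h1; rewrite /= pairingZl pairing0l mul1r addr0 cvar_pieceE.
  by case: (leP (phi (Zhat i) - dv_t v) 0) => _; lra.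
rewrite -leeBlDr//; apply: le_ereal_inf_tmp => _ [t _ <-].
rewrite leeBlDr// -EFinD /cvar_objective addrAC mulrCA addrC mulr_sumr -avg_add.
apply: (dro_pep_le_transport _ _ _ t c) => [|j|j|i j].
- by rewrite sumr_ge0.
- by case: ifP => _ /=; [exact: symmxZ|rewrite /symmx trmx0].
- by rewrite /c (bigD1 j)//= lerDl sumr_ge0.
case: ifP => _.
  rewrite pairingZl cvar_pieceE.
  have : alpha^-1 * (phi (Zhat i) - t) <= alpha^-1 * Num.max (phi (Zhat i) - t) 0.
    by rewrite ler_pM2l ?invr_gt0// le_max lexx.
  lra.
have : 0 <= alpha^-1 * Num.max (phi (Zhat i) - t) 0.
  by rewrite mulr_ge0 ?invr_ge0 ?(ltW halpha0)// le_max lexx orbT.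
by rewrite pairing0l; lra.
Qed.

Lemma worst_fin_num : worst \is a fin_num.
Proof.
have [D D0 HD] := lifted_set_bounded (K := K) (eta := eta) hmu hmuL r.
have lZ := hZhat (Ordinal N0).
rewrite fin_real//; apply/andP; split.
  apply: (@lt_le_trans _ _ (phi (Zhat (Ordinal N0)))%:E); first exact: ltNyr.
  by apply: ereal_sup_ubound; exists (Zhat (Ordinal N0)).
apply: (@le_lt_trans _ _ (gf_norm (Aobj, bobj) * D)%:E); last exact: ltry.
apply: ge_ereal_sup => _ [Z lZ' <-]; rewrite lee_fin.
apply: le_trans (ler_norm _) _; apply: le_trans (pairing_norm_le _ _) _.
by apply: ler_wpM2l (HD _ lZ'); exact: sqrtr_ge0.
Qed.

Lemma dro_le_worst eps : (vE eps <= worst)%E /\ (vC eps <= worst)%E.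
Proof.
have lZ := hZhat (Ordinal N0).
rewrite -(fineK worst_fin_num); set w := fine _.
have ai : 0 < alpha^-1 by rewrite invr_gt0.
have lt_w d Z : 0 < d -> lifted_set mu L eta r Z -> phi Z < w + d.
  move=> d0 lZ'; rewrite (@le_lt_trans _ _ w)// ?ltrDl//.
  rewrite -lee_fin /w (fineK worst_fin_num).
  by apply: ereal_sup_ubound; exists Z.
split; apply/lee_addgt0Pr => d d0; rewrite -EFinD.
  apply: (dro_pep_le_dual N0 _ _ _ 0 _ (fun=> w + d)) => // [_|j].
    by apply: (pep_strong_duality hmu hmuL _ _ _ _ lZ) => // Z; exact: lt_w.
  by rewrite mul0r add0r.
(* with t = w + d the certified bounds of both pieces are equal to w + d *)
apply: (dro_pep_le_dual N0 _ _ _ (w + d) _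
  (fun j => if j == ord0 then alpha^-1 * (w + d) else 0)) => // [j|j].
  case: ifP => _.
    apply: (pep_strong_duality hmu hmuL _ _ _ _ lZ) => [|Z lZ'].
      exact: symmxZ.
    by rewrite pairingZl ltr_pM2l//; exact: lt_w.
  by exists (fun=> 0), 0; exact: pep_dual0.
case: ifP => _; last by rewrite mul1r addr0.
by rewrite cvar_pieceE subrr mulr0 addr0.
Qed.

(** The threshold is a bound on the diameter of the lifted set.  For the CVaR
    version, t + alpha^-1 max(x - t, 0) >= x since alpha <= 1. *)
Lemma dro_ge_worst : exists2 eps0 : R, 0 < eps0 &
  forall eps, eps0 <= eps -> (worst <= vE eps)%E /\ (worst <= vC eps)%E.
Proof.
have [D D0 HD] := lifted_set_bounded (K := K) (eta := eta) hmu hmuL r.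
exists (D + D + 1); first by rewrite ltr_wpDl// addr_ge0.
move=> eps he.
have diam Z i : lifted_set mu L eta r Z -> gf_norm1 (Z - Zhat i) <= eps.
  move=> lZ; apply: le_trans (gf_norm1_le_add _ _) _.
  by have := HD _ lZ; have := HD _ (hZhat i); lra.
split; apply: ge_ereal_sup => _ [Z lZ <-]; apply: dro_pep_ge => v fv.
  rewrite -(avg_cst (phi Z)); apply: dro_objective_ge => i.
  have := dro_feasible_worst _ _ _ v _ i ord0 (diam _ i lZ) fv lZ.
  by rewrite mul0r add0r.
rewrite -(avg_cst (phi Z)); apply: dro_objective_ge => i.
have := dro_feasible_worst _ _ _ v _ i ord0 (diam _ i lZ) fv lZ.
have := dro_feasible_worst _ _ _ v _ i ord_max (diam _ i lZ) fv lZ.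
rewrite /= pairingZl pairing0l mul1r addr0 cvar_pieceE.
have [zt|zt] := leP (phi Z) (dv_t v); first by move=> h _; exact: le_trans h.
have : (phi Z - dv_t v) <= alpha^-1 * (phi Z - dv_t v).
  by rewrite ler_peMl ?subr_ge0 ?(ltW zt)// invf_ge1.
lra.
Qed.

End OptimalValues.

Theorem theorem3 (R : realType) (mu L : R) (hmu : 0 <= mu) (hmuL : mu < L)
    (K : nat) (hK : (1 <= K)%N)
    (eta : nat -> nat -> R) (heta : forall k, (k < K)%N -> eta k k != 0)
    (r : R) (hr : 0 < r)
    (N : nat) (hN : (0 < N)%N) (Zhat : 'I_N -> gf_space R K)
    (hZhat : forall i, lifted_set mu L eta r (Zhat i))
    (Aobj : 'M[R]_K.+2) (hAobj : symmx Aobj) (bobj : 'cV[R]_K.+1)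
    (alpha : R) (halpha0 : 0 < alpha) (halpha1 : alpha <= 1) :
  let phi (Z : gf_space R K) : R := pairing (Aobj, bobj) Z in
  let vE eps := dro_pep_expectation mu L eta r Zhat Aobj bobj eps in
  let vC eps := dro_pep_cvar mu L eta r Zhat Aobj bobj alpha eps in
  let worst := ereal_sup [set (phi Z)%:E | Z in lifted_set mu L eta r] in
  [/\ vE eps @[eps --> 0^'+] --> (N%:R^-1 * \sum_(i < N) phi (Zhat i))%:E,
      vC eps @[eps --> 0^'+] -->
        CVaR (empirical (Zhat : 'I_N -> borel_gf R K) hN) alpha phi
    & exists2 eps0 : R, 0 < eps0 &
        forall eps, eps0 <= eps -> vE eps = worst /\ vC eps = worst].
Proof.
move=> phi vE vC worst; split.
- apply: (@cvge_linear_squeeze _ _ _ (gf_norm (- (Aobj, bobj)))) => eps e0.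
  exact: (expectation_near_sample hN hZhat hAobj eps e0).
- rewrite CVaR_empirical.
  have [c hc] := cvar_near_sample hN hZhat hAobj (bobj := bobj) halpha0.
  exact: (@cvge_linear_squeeze _ _ _ c hc).
- have [eps0 e0 ge] :=
    dro_ge_worst hmu hmuL hN hZhat (Aobj := Aobj) (bobj := bobj) halpha0 halpha1.
  exists eps0 => // eps /ge[geE geC].
  have [leE leC] :=
    dro_le_worst hmu hmuL hN hZhat hAobj (bobj := bobj) halpha0 eps.
  by split; apply/eqP; rewrite eq_le ?leE ?leC.
Qed.
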